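(* Let $n\in\mathbb{N}_0$ and $m\in\mathbb{N}$, let $a,b\in\mathbb{R}$ with $b\neq0$, and let $I\subset\mathbb{R}$ be an open interval on which $a+bq>0$. Then, as indefinite integrals in $q$ on $I$ (up to an additive constant), $$\int q^{n}\,\psi^{(-m)}(a+bq)\,dq=n!\sum_{j=0}^{n}\frac{(-1)^j}{b^{j+1}(n-j)!}\,q^{n-j}\,\psi^{(-m-j-1)}(a+bq),$$ that is, the right-hand side is an antiderivative on $I$ of $q^n\psi^{(-m)}(a+bq)$.
   Context: $\mathbb{N}=\{1,2,\dots\}$, $\mathbb{N}_0=\{0,1,2,\dots\}$. For $k\in\mathbb{N}$ and $q>0$ the balanced negapolygamma function is $$\psi^{(-k)}(q)=\frac{1}{k!}\left[A_k(q)-H_{k-1}B_k(q)\right],\qquad A_k(q)=k\,\frac{\partial}{\partial z}\zeta(z,q)\Big|_{z=1-k},$$ where $\zeta(z,q)$ is the Hurwitz zeta function ($\zeta(z,q)=\sum_{n\ge0}(n+q)^{-z}$ for $\operatorname{Re}z>1$, analytically continued in $z$ to $\mathbb{C}\setminus\{1\}$), $B_k(q)$ is the $k$-th Bernoulli polynomial, given by $\frac{te^{qt}}{e^t-1}=\sum_{k\ge0}B_k(q)\frac{t^k}{k!}$, and $H_r=\sum_{i=1}^r 1/i$ is the harmonic number ($H_0=0$). *)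

(* Defs.v *)
From Stdlib Require Import Reals Factorial ClassicalEpsilon.
From Coquelicot Require Import Coquelicot.

Open Scope R_scope.

(* x ^ w for real x > 0 and complex w, with the real logarithm of x:
   exp (w ln x) = exp (Re w ln x) (cos (Im w ln x) + i sin (Im w ln x)). *)
Definition pos_Cpower (x : R) (w : C) : C :=
  (RtoC (exp (Re w * ln x)) * (cos (Im w * ln x), sin (Im w * ln x)))%C.

Definition C_analytic_at (f : C -> C) (z0 : C) : Prop :=
  exists (c : nat -> C) (r : R), 0 < r /\
    forall z : C, Cmod (z - z0)%C < r ->
      is_pseries (K := C_AbsRing) (V := C_NormedModule) c (z - z0)%C (f z).

(* Since C \ {1} is connected, this determines Z on C \ {1};
   Z (RtoC 1) is left arbitrary. *)
Definition is_Hurwitz_zeta (q : R) (Z : C -> C) : Prop :=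
  (forall z : C, 1 < Re z ->
     is_series (K := C_AbsRing) (V := C_NormedModule)
       (fun n : nat => pos_Cpower (INR n + q) (- z)%C) (Z z)) /\
  (forall z : C, z <> RtoC 1 -> C_analytic_at Z z).

(* Only meaningful for q > 0 and z <> 1. *)
Definition Hurwitz_zeta (z : C) (q : R) : C :=
  epsilon (inhabits (fun _ : C => RtoC 0)) (is_Hurwitz_zeta q) z.

(* The generating function identity for t near 0; the point t = 0, where the
   quotient has a removable singularity, is excluded because 0 / 0 = 0 here. *)
Definition is_Bernoulli (q : R) (B : nat -> R) : Prop :=
  exists r : R, 0 < r /\
    forall t : R, t <> 0 -> Rabs t < r ->
      is_pseries (fun k : nat => B k / INR (fact k)) t
        (t * exp (q * t) / (exp t - 1)).

Definition Bernoulli_poly (k : nat) (q : R) : R :=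
  epsilon (inhabits (fun _ : nat => 0)) (is_Bernoulli q) k.

Definition harmonic (r : nat) : R := sum_n_m (fun i : nat => / INR i) 1 r.

Definition A_neg (k : nat) (q : R) : C :=
  (RtoC (INR k)
   * C_derive (fun z : C => Hurwitz_zeta z q) (RtoC (1 - INR k)))%C.

(* [negapolygamma k q] is psi^(-k)(q), for k >= 1 and q > 0.  Its values are
   real, but they are kept in C, where the derivative of zeta lives. *)
Definition negapolygamma (k : nat) (q : R) : C :=
  (RtoC (/ INR (fact k))
   * (A_neg k q - RtoC (harmonic (k - 1) * Bernoulli_poly k q)))%C.

(* Main.v *)
Require Import Defs.
From Stdlib Require Import Reals Factorial Lra Lia ClassicalEpsilon Wf_nat.
From Coquelicot Require Import Coquelicot.
Open Scope R_scope.

(** Write [G(z,q) = (z - 1) zeta(z,q)], an entire function of [z].  Integrating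
by parts over [[q, q+1]] gives
[G(z,q) = q^(1-z) + (z-1) int_0^1 (1-u) G(z+1, q+u) du],
with no pole left, so that iterating the right-hand side from the half-plane
[Re z > 1] constructs the continuation.  Together with the Raabe formula
[int_q^(q+1) G(z,t) dt = q^(1-z)] this recursion yields
[dG(z,q)/dq = -(z-1) G(z+1,q)], coefficient by coefficient in the Taylor expansion
in [z].  At the points [1-k] it characterizes [G(1-k,q) = B_k(q)], and
[psi^(-m)(q) = -(G'(1-m,q) + H_m B_m(q)) / m!] then has derivative
[psi^(-m+1)(q)].  The identity theorem along the segment from [2+i] to [1-m],
which avoids the pole, identifies the continuation chosen by [Hurwitz_zeta] with
[G(z,q)/(z-1)] near [1-m].  The sum in the theorem telescopes on differentiation. *)

(** * Complex-valued functions of a real variable *)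

(** The obstacle is that psi^(-m) is a z-derivative of zeta, so the theorem needs the mixed
    derivative of G in z and q. Differentiation under an integral and the exchange of partial
    derivatives are avoided by never differentiating in z: the Taylor coefficients in z are carried
    along with the error bounds of [taylor]. Integration over a unit interval preserves these bounds
    with the same constants, so each identity between functions of z becomes one between
    coefficients. In such an identity the factor z - 1 + w turns into a shift of the index. The
    shift is the source of the extra term -G(1-m,q) in the q-derivative of G'(-m,q). The weight H_m
    is exactly what absorbs it, because (m+1) H_(m+1) = (m+1) H_m + 1. Working with G rather than
    zeta keeps the point z = 1 out of every stage of the continuation; the division by z - 1 happens
    only when the result is compared with [Hurwitz_zeta]. *)

Lemma C_ext (u v : C) : Re u = Re v -> Im u = Im v -> u = v.
Proof. destruct u, v; simpl; intros; subst; reflexivity. Qed.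

Lemma Cmod_nonneg_le_of_sqr (v : C) (M : R) :
  0 <= M -> Cmod v * Cmod v <= Cmod v * M -> Cmod v <= M.
Proof.
  intros HM H. destruct (Rle_lt_dec (Cmod v) 0) as [h|h]; [lra|].
  apply Rmult_le_reg_l with (Cmod v); auto.
Qed.

(** Componentwise, so that the real mean value theorem and the real integral apply directly. The
    normed-module derivative of the theorem is recovered only at the end, by [derivC_is_derive]. *)
Definition derivC (f : R -> C) (x : R) (l : C) : Prop :=
  is_derive (fun t => Re (f t)) x (Re l) /\ is_derive (fun t => Im (f t)) x (Im l).

Definition contC (f : R -> C) (x : R) : Prop :=
  continuous (fun t => Re (f t)) x /\ continuous (fun t => Im (f t)) x.

Lemma derivC_eq (f : R -> C) (x : R) (l l' : C) : derivC f x l -> l = l' -> derivC f x l'.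
Proof. intros H <-; exact H. Qed.

Lemma derivC_ext (f g : R -> C) (x : R) (l : C) :
  (forall t, f t = g t) -> derivC f x l -> derivC g x l.
Proof.
  intros E [H1 H2]; split.
  - eapply is_derive_ext; [|exact H1]. intros; simpl; now rewrite E.
  - eapply is_derive_ext; [|exact H2]. intros; simpl; now rewrite E.
Qed.

Lemma locally_pos (x : R) (P : R -> Prop) : 0 < x -> (forall t, 0 < t -> P t) -> locally x P.
Proof.
  intros Hx H. exists (mkposreal x Hx). intros y Hy. apply H.
  unfold ball, AbsRing_ball in Hy; simpl in Hy.
  unfold AbsRing_ball, minus, plus, opp, abs in Hy; simpl in Hy.
  apply Rabs_def2 in Hy. lra.
Qed.

Lemma derivC_ext_pos (f g : R -> C) (x : R) (l : C) : 0 < x ->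
  (forall t, 0 < t -> f t = g t) -> derivC f x l -> derivC g x l.
Proof.
  intros Hx E [H1 H2]; split.
  - eapply is_derive_ext_loc; [|exact H1].
    apply locally_pos; auto. intros; simpl; now rewrite E.
  - eapply is_derive_ext_loc; [|exact H2].
    apply locally_pos; auto. intros; simpl; now rewrite E.
Qed.

Lemma derivC_const (c : C) (x : R) : derivC (fun _ => c) x 0.
Proof. split; simpl; apply @is_derive_const. Qed.

Lemma derivC_plus (f g : R -> C) (x : R) (l m : C) :
  derivC f x l -> derivC g x m -> derivC (fun t => f t + g t)%C x (l + m)%C.
Proof.
  intros [H1 H2] [H3 H4]; split; simpl.
  - apply (is_derive_plus (fun t => Re (f t)) (fun t => Re (g t))); assumption.
  - apply (is_derive_plus (fun t => Im (f t)) (fun t => Im (g t))); assumption.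
Qed.

Lemma derivC_opp (f : R -> C) (x : R) (l : C) :
  derivC f x l -> derivC (fun t => - f t)%C x (- l)%C.
Proof.
  intros [H1 H2]; split; simpl.
  - apply (is_derive_opp (fun t => Re (f t))); assumption.
  - apply (is_derive_opp (fun t => Im (f t))); assumption.
Qed.

Lemma derivC_minus (f g : R -> C) (x : R) (l m : C) :
  derivC f x l -> derivC g x m -> derivC (fun t => f t - g t)%C x (l - m)%C.
Proof. intros H1 H2. apply derivC_plus; [|apply derivC_opp]; assumption. Qed.

Lemma is_derive_mult_R (f g : R -> R) (x l m : R) :
  is_derive f x l -> is_derive g x m ->
  is_derive (fun t => f t * g t) x (l * g x + f x * m).
Proof. intros; apply (is_derive_mult f g); auto. intros; apply Rmult_comm. Qed.

Lemma derivC_mult (f g : R -> C) (x : R) (l m : C) :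
  derivC f x l -> derivC g x m -> derivC (fun t => f t * g t)%C x (l * g x + f x * m)%C.
Proof.
  intros [H1 H2] [H3 H4]; split; simpl.
  - evar_last.
    + apply (is_derive_minus (fun t => Re (f t) * Re (g t)) (fun t => Im (f t) * Im (g t)));
        apply is_derive_mult_R; eassumption.
    + unfold minus, plus, opp; simpl. unfold Re, Im. ring.
  - evar_last.
    + apply (is_derive_plus (fun t => Re (f t) * Im (g t)) (fun t => Im (f t) * Re (g t)));
        apply is_derive_mult_R; eassumption.
    + unfold plus; simpl. unfold Re, Im. ring.
Qed.

Lemma derivC_scal (c : C) (f : R -> C) (x : R) (l : C) :
  derivC f x l -> derivC (fun t => c * f t)%C x (c * l)%C.
Proof.
Proof.
  intros H. eapply derivC_eq; [apply derivC_mult; [apply derivC_const|exact H]|]. cbv beta. ring.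
Qed.

Lemma derivC_RtoC (f : R -> R) (x l : R) : is_derive f x l -> derivC (fun t => RtoC (f t)) x (RtoC l).
Proof. intros H; split; simpl; [exact H|apply @is_derive_const]. Qed.

Lemma derivC_comp (f : R -> C) (u : R -> R) (x : R) (l : C) (du : R) :
  derivC f (u x) l -> is_derive u x du -> derivC (fun t => f (u t)) x (RtoC du * l)%C.
Proof.
  intros [H1 H2] Hu; split.
  - evar_last.
    + apply (is_derive_comp (fun t => Re (f t)) u); eassumption.
    + unfold scal; simpl; unfold mult; simpl. unfold Re, Im; ring.
  - evar_last.
    + apply (is_derive_comp (fun t => Im (f t)) u); eassumption.
    + unfold scal; simpl; unfold mult; simpl. unfold Re, Im; ring.
Qed.

Lemma derivC_is_derive (f : R -> C) (x : R) (l : C) :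
  derivC f x l -> is_derive (K := R_AbsRing) (V := C_R_NormedModule) f x l.
Proof.
  intros [H1 H2].
  apply (filterdiff_ext_lin (K := R_AbsRing) (U := R_NormedModule) (V := C_R_NormedModule)
    f (fun y => (scal y (Re l), scal y (Im l)) : C)).
  2:{ intros y. unfold scal; simpl; unfold prod_scal; destruct l; reflexivity. }
  apply (filterdiff_ext (K := R_AbsRing) (U := R_NormedModule) (V := C_R_NormedModule)
    (fun t => (Re (f t), Im (f t)) : C)).
  { intros y; destruct (f y); reflexivity. }
  (* Pairing the components is the identity of R * R, a linear map and hence its own
     differential. *)
  apply (filterdiff_comp'_2 (fun t => Re (f t)) (fun t => Im (f t))
    (fun u v => (u, v) : C_R_NormedModule) x
    (fun y => scal y (Re l)) (fun y => scal y (Im l)) (fun u v => (u, v) : C_R_NormedModule)).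
  - exact H1.
  - exact H2.
  - apply filterdiff_linear.
    apply (is_linear_ext (fun t : R * R => t)); [intros [u v]; reflexivity|].
    apply is_linear_id.
Qed.

Lemma derivC_contC (f : R -> C) (x : R) (l : C) : derivC f x l -> contC f x.
Proof.
  intros [H1 H2]; split.
  - apply (ex_derive_continuous (K := R_AbsRing) (V := R_NormedModule) (fun t => Re (f t))). now exists (Re l).
  - apply (ex_derive_continuous (K := R_AbsRing) (V := R_NormedModule) (fun t => Im (f t))). now exists (Im l).
Qed.

Lemma contC_const (c : C) (x : R) : contC (fun _ => c) x.
Proof. exact (derivC_contC _ _ _ (derivC_const c x)). Qed.

Lemma contC_plus (f g : R -> C) (x : R) : contC f x -> contC g x -> contC (fun t => f t + g t)%C x.
Proof.
  intros [H1 H2] [H3 H4]; split; simpl.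
  - apply (continuous_plus (K := R_AbsRing) (V := R_NormedModule) (fun t => Re (f t)) (fun t => Re (g t))); assumption.
  - apply (continuous_plus (K := R_AbsRing) (V := R_NormedModule) (fun t => Im (f t)) (fun t => Im (g t))); assumption.
Qed.

Lemma continuous_scal_R (c : R) (f : R -> R) (x : R) :
  continuous f x -> continuous (fun t => c * f t) x.
Proof. intros H. apply (continuous_mult (K := R_AbsRing) (fun _ => c) f); [apply continuous_const|exact H]. Qed.

Lemma contC_scal (c : C) (f : R -> C) (x : R) : contC f x -> contC (fun t => c * f t)%C x.
Proof.
  intros [H1 H2]; split; simpl.
  - apply (continuous_minus (K := R_AbsRing) (V := R_NormedModule) (fun t => fst c * Re (f t)) (fun t => snd c * Im (f t)));
    apply continuous_scal_R; assumption.
  - apply (continuous_plus (K := R_AbsRing) (V := R_NormedModule) (fun t => fst c * Im (f t)) (fun t => snd c * Re (f t)));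
    apply continuous_scal_R; assumption.
Qed.

Lemma contC_minus (f g : R -> C) (x : R) : contC f x -> contC g x -> contC (fun t => f t - g t)%C x.
Proof.
  intros H1 [H2 H3]. apply contC_plus; auto. split; simpl.
  - apply (continuous_opp (K := R_AbsRing) (V := R_NormedModule) (fun t => Re (g t))); assumption.
  - apply (continuous_opp (K := R_AbsRing) (V := R_NormedModule) (fun t => Im (g t))); assumption.
Qed.

Lemma continuous_R_eps (f : R -> R) (x : R) :
  continuous f x <->
  forall e, 0 < e -> exists d, 0 < d /\ forall y, Rabs (y - x) < d -> Rabs (f y - f x) < e.
Proof.
  split.
  - intros H e He.
    destruct (H (fun y => Rabs (y - f x) < e)) as [d Hd].
    { exists (mkposreal e He). intros y Hy. exact Hy. }
    exists d. split; [apply d|]. intros y Hy. apply Hd. exact Hy.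
  - intros H P [e He].
    destruct (H e (cond_pos e)) as [d [Hd Hd']].
    exists (mkposreal d Hd). intros y Hy. apply He. apply Hd'. exact Hy.
Qed.

Lemma Rabs_Re_le (z : C) : Rabs (Re z) <= Cmod z.
Proof. apply re_le_Cmod. Qed.

Lemma Rabs_Im_le (z : C) : Rabs (Im z) <= Cmod z.
Proof.
  eapply Rle_trans; [apply Rmax_r|]. apply (Rmax_Cmod z).
Qed.

Lemma Cmod_le_Re_Im (z : C) : Cmod z <= Rabs (Re z) + Rabs (Im z).
Proof.
  unfold Cmod. apply Rsqr_incr_0_var.
  - rewrite Rsqr_sqrt by (simpl; nra).
    unfold Rsqr, Re, Im. generalize (Rabs_pos (fst z)) (Rabs_pos (snd z)).
    rewrite <- (pow2_abs (fst z)), <- (pow2_abs (snd z)). intros; nra.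
  - apply Rplus_le_le_0_compat; apply Rabs_pos.
Qed.

Lemma contC_eps (f : R -> C) (x : R) :
  contC f x <->
  forall e, 0 < e -> exists d, 0 < d /\ forall y, Rabs (y - x) < d -> Cmod (f y - f x)%C < e.
Proof.
  split.
  - intros [H1 H2] e He.
    rewrite continuous_R_eps in H1, H2.
    destruct (H1 (e/2) ltac:(lra)) as [d1 [P1 Q1]].
    destruct (H2 (e/2) ltac:(lra)) as [d2 [P2 Q2]].
    exists (Rmin d1 d2). split; [now apply Rmin_glb_lt|].
    intros y Hy. eapply Rle_lt_trans; [apply Cmod_le_Re_Im|].
    specialize (Q1 y (Rlt_le_trans _ _ _ Hy (Rmin_l _ _))).
    specialize (Q2 y (Rlt_le_trans _ _ _ Hy (Rmin_r _ _))).
    unfold Re, Im in *. simpl. unfold Rminus in *. lra.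
  - intros H; split; apply continuous_R_eps; intros e He;
    destruct (H e He) as [d [P Q]]; exists d; split; auto; intros y Hy;
    (eapply Rle_lt_trans; [|exact (Q y Hy)]).
    + apply (Rabs_Re_le (f y - f x)%C).
    + apply (Rabs_Im_le (f y - f x)%C).
Qed.

Lemma contC_of_uniform_approx (f : R -> C) (x : R) :
  (forall e, 0 < e -> exists h d, 0 < d /\ contC h x /\
     forall y, Rabs (y - x) < d -> Cmod (f y - h y)%C <= e) ->
  contC f x.
Proof.
  intros H. apply contC_eps. intros e He.
  destruct (H (e/4) ltac:(lra)) as [h [d [Hd [Hh Hfh]]]].
  rewrite contC_eps in Hh. destruct (Hh (e/4) ltac:(lra)) as [d' [Hd' Hh']].
  exists (Rmin d d'). split; [now apply Rmin_glb_lt|]. intros y Hy.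
  assert (A1 := Hfh y (Rlt_le_trans _ _ _ Hy (Rmin_l _ _))).
  assert (A2 := Hh' y (Rlt_le_trans _ _ _ Hy (Rmin_r _ _))).
  assert (A3 : Cmod (f x - h x)%C <= e/4).
  { apply Hfh. rewrite Rminus_diag, Rabs_R0; auto. }
  replace (f y - f x)%C with ((f y - h y) + (h y - h x) + - (f x - h x))%C by ring.
  eapply Rle_lt_trans; [apply Cmod_triangle|].
  rewrite Cmod_opp.
  assert (B := Cmod_triangle (f y - h y)%C (h y - h x)%C). lra.
Qed.

(* Project onto the direction of the increment to reduce to the real mean value theorem. *)
Lemma Cmod_increment_le (f f' : R -> C) (g g' : R -> R) (a b : R) :
  a <= b ->
  (forall x, a <= x <= b -> derivC f x (f' x)) ->
  (forall x, a <= x <= b -> is_derive g x (g' x)) ->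
  (forall x, a <= x <= b -> Cmod (f' x) <= g' x) ->
  Cmod (f b - f a)%C <= g b - g a.
Proof.
  intros Hab Hf Hg Hle.
  set (v := (f b - f a)%C).
  set (phi := fun x => (Re v * Re (f x) + Im v * Im (f x)) - Cmod v * g x).
  set (phi' := fun x => (Re v * Re (f' x) + Im v * Im (f' x)) - Cmod v * g' x).
  assert (Hphi : forall x, a <= x <= b -> is_derive phi x (phi' x)).
  { intros x Hx. destruct (Hf x Hx) as [H1 H2]. specialize (Hg x Hx).
    unfold phi, phi'.
    apply (is_derive_minus (fun x => Re v * Re (f x) + Im v * Im (f x)) (fun x => Cmod v * g x)).
    - apply (is_derive_plus (fun x => Re v * Re (f x)) (fun x => Im v * Im (f x)));
      apply (is_derive_scal (fun x => _)); assumption.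
    - apply is_derive_scal; assumption. }
  assert (Hphi' : forall x, a <= x <= b -> phi' x <= 0).
  { intros x Hx. unfold phi'. specialize (Hle x Hx).
    (* Cauchy-Schwarz, read off from the real part of the product of [Cconj v] and [f' x]. *)
    assert (CS : Re v * Re (f' x) + Im v * Im (f' x) <= Cmod v * Cmod (f' x)).
    { replace (Cmod v) with (Cmod (Cconj v)) by apply Cmod_conj.
      rewrite <- Cmod_mult.
      eapply Rle_trans; [|eapply Rle_trans; [apply Rle_abs|apply (Rabs_Re_le (Cconj v * f' x)%C)]].
      simpl. unfold Re, Im. right; ring. }
    assert (Cmod v * Cmod (f' x) <= Cmod v * g' x).
    { apply Rmult_le_compat_l; auto. apply Cmod_ge_0. }
    lra. }
  destruct (MVT_gen phi a b phi') as [c [Hc Hc']].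
  - rewrite Rmin_left, Rmax_right by assumption. intros; apply Hphi; lra.
  - rewrite Rmin_left, Rmax_right by assumption. intros x Hx.
    apply continuity_pt_filterlim.
    apply (ex_derive_continuous (K := R_AbsRing) (V := R_NormedModule) phi). exists (phi' x). now apply Hphi.
  - rewrite Rmin_left, Rmax_right in Hc by assumption.
    specialize (Hphi' c Hc).
    assert (Hd : phi b - phi a <= 0) by (rewrite Hc'; nra).
    (* Covers the case v = 0, where an inequality multiplied by [Cmod v] carries no information. *)
    assert (Hgab : 0 <= g b - g a).
    { destruct (MVT_gen g a b g') as [d [Hd1 Hd2]].
      - rewrite Rmin_left, Rmax_right by assumption. intros; apply Hg; lra.
      - rewrite Rmin_left, Rmax_right by assumption. intros x Hx.
        apply continuity_pt_filterlim.
        apply (ex_derive_continuous (K := R_AbsRing) (V := R_NormedModule) g). exists (g' x). now apply Hg.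
      - rewrite Rmin_left, Rmax_right in Hd1 by assumption.
        rewrite Hd2. assert (0 <= g' d) by (eapply Rle_trans; [apply Cmod_ge_0|apply Hle; auto]). nra. }
    apply Cmod_nonneg_le_of_sqr; auto.
    assert (E : Cmod v * Cmod v = Re v * Re v + Im v * Im v).
    { replace (Cmod v * Cmod v) with (Cmod v ^ 2) by ring. rewrite Cmod2_alt. ring. }
    rewrite E. unfold phi in Hd.
    assert (E1 : Re v = Re (f b) - Re (f a)) by reflexivity.
    assert (E2 : Im v = Im (f b) - Im (f a)) by reflexivity.
    assert (Re v * Re v + Im v * Im v =
      (Re v * Re (f b) + Im v * Im (f b)) - (Re v * Re (f a) + Im v * Im (f a))).
    { rewrite E1, E2; ring. }
    lra.
Qed.

Lemma Cmod_increment_le_const (f f' : R -> C) (M a b : R) :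
  a <= b ->
  (forall x, a <= x <= b -> derivC f x (f' x)) ->
  (forall x, a <= x <= b -> Cmod (f' x) <= M) ->
  Cmod (f b - f a)%C <= M * (b - a).
Proof.
  intros Hab Hf Hle.
  replace (M * (b - a)) with (M * b - M * a) by ring.
  apply (Cmod_increment_le f f' (fun x => M * x) (fun _ => M)); auto.
  intros x _. evar_last; [apply is_derive_scal, is_derive_id|].
  unfold one; simpl; ring.
Qed.

Lemma derivC_zero_eq (f : R -> C) (a b : R) : a <= b ->
  (forall x, a <= x <= b -> derivC f x 0) -> f a = f b.
Proof.
  intros Hab H.
  assert (A := Cmod_increment_le_const f (fun _ => 0) 0 a b Hab H).
  assert (B : Cmod (f b - f a)%C = 0).
  { apply Rle_antisym; [|apply Cmod_ge_0]. rewrite Rmult_0_l in A. apply A.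
    intros; rewrite Cmod_0; lra. }
  apply Cmod_eq_0 in B.
  replace (f b) with ((f b - f a) + f a)%C by ring. rewrite B. ring.
Qed.

(** The upper index is excluded so that the empty sum exists: a Taylor estimate of order 0 is then a
    plain bound on the function. [sum_n] always has at least one term. *)
Fixpoint csum (n : nat) (a : nat -> C) : C :=
  match n with O => 0 | S k => (csum k a + a k)%C end.

Lemma csum_sum_n (a : nat -> C) (n : nat) :
  sum_n (G := C_AbelianMonoid) a n = csum (S n) a.
Proof.
  induction n; [rewrite sum_O; simpl; ring|].
  rewrite sum_Sn, IHn. reflexivity.
Qed.

Lemma csum_ext (n : nat) (a b : nat -> C) :
  (forall k, (k < n)%nat -> a k = b k) -> csum n a = csum n b.
Proof. induction n; simpl; intros; auto. rewrite IHn, H; auto. Qed.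

Lemma csum_plus (n : nat) (a b : nat -> C) :
  csum n (fun k => a k + b k)%C = (csum n a + csum n b)%C.
Proof. induction n; simpl; [ring|rewrite IHn; ring]. Qed.

Lemma csum_minus (n : nat) (a b : nat -> C) :
  csum n (fun k => a k - b k)%C = (csum n a - csum n b)%C.
Proof. induction n; simpl; [ring|rewrite IHn; ring]. Qed.

Lemma csum_scal (c : C) (n : nat) (a : nat -> C) :
  csum n (fun k => c * a k)%C = (c * csum n a)%C.
Proof. induction n; simpl; [ring|rewrite IHn; ring]. Qed.

Lemma csum_shift (n : nat) (a : nat -> C) :
  csum (S n) a = (a O + csum n (fun k => a (S k)))%C.
Proof. induction n; [simpl; ring|]. simpl in *. rewrite IHn. ring. Qed.

Lemma csum_split (n m : nat) (a : nat -> C) :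
  csum (n + m) a = (csum n a + csum m (fun k => a (n + k)%nat))%C.
Proof.
  induction m; simpl; [rewrite Nat.add_0_r; ring|].
  rewrite Nat.add_succ_r; simpl. rewrite IHm. ring.
Qed.

Lemma csum_telescope (n : nat) (a : nat -> C) :
  csum n (fun k => a (S k) - a k)%C = (a n - a O)%C.
Proof. induction n; simpl; [ring|rewrite IHn; ring]. Qed.

Lemma csum_zero (n : nat) (a : nat -> C) : (forall k, (k < n)%nat -> a k = 0) -> csum n a = 0.
Proof. induction n; simpl; intros; auto. rewrite IHn, H by auto. ring. Qed.

Lemma Cmod_csum_le (n : nat) (a : nat -> C) (u : nat -> R) :
  (forall k, Cmod (a k) <= u k) -> Cmod (csum (S n) a) <= sum_n u n.
Proof.
  intros H. induction n.
  - rewrite sum_O. simpl. replace (0 + a O)%C with (a O) by ring. apply H.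
  - rewrite sum_Sn. change (csum (S (S n)) a) with (csum (S n) a + a (S n))%C.
    eapply Rle_trans; [apply Cmod_triangle|]. apply Rplus_le_compat; auto.
Qed.

Lemma derivC_csum (n : nat) (f : nat -> R -> C) (x : R) (l : nat -> C) :
  (forall k, (k < n)%nat -> derivC (f k) x (l k)) -> derivC (fun t => csum n (fun k => f k t)) x (csum n l).
Proof.
  induction n; simpl; intros H; [apply derivC_const|].
  apply derivC_plus; auto.
Qed.

Lemma contC_csum (n : nat) (f : nat -> R -> C) (x : R) :
  (forall k, (k < n)%nat -> contC (f k) x) -> contC (fun t => csum n (fun k => f k t)) x.
Proof.
  induction n; simpl; intros H; [apply contC_const|].
  apply contC_plus; auto.
Qed.

(** * Taylor expansions with geometric error bounds *)

(** The function exp(w L) with L in place of ln x: the Taylor remainder in w is estimated by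
    differentiating in the real variable L. *)
Definition cexp (L : R) (w : C) : C :=
  (RtoC (exp (Re w * L)) * (cos (Im w * L), sin (Im w * L)))%C.

Lemma pos_Cpower_cexp (x : R) (w : C) : pos_Cpower x w = cexp (ln x) w.
Proof. reflexivity. Qed.

Lemma cexp_plus (L : R) (a b : C) : cexp L (a + b)%C = (cexp L a * cexp L b)%C.
Proof.
  unfold cexp. apply C_ext; simpl; unfold Re, Im; simpl;
  rewrite !Rmult_plus_distr_r, exp_plus.
  - rewrite cos_plus, sin_plus; ring.
  - rewrite cos_plus, sin_plus; ring.
Qed.

Lemma cexp_0 (L : R) : cexp L 0 = 1.
Proof.
  unfold cexp. simpl. rewrite !Rmult_0_l, exp_0, cos_0, sin_0. apply C_ext; simpl; ring.
Qed.

Lemma Cmod_cexp (L : R) (w : C) : Cmod (cexp L w) = exp (Re w * L).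
Proof.
  unfold cexp. rewrite Cmod_mult, Cmod_R, Rabs_right by (left; apply exp_pos).
  replace (Cmod (cos (Im w * L), sin (Im w * L))) with 1; [ring|].
  unfold Cmod; simpl. rewrite <- sqrt_1 at 1. f_equal.
  assert (A := sin2_cos2 (Im w * L)). unfold Rsqr in A. lra.
Qed.

Lemma cexp_opp (L : R) (w : C) : cexp (- L) w = cexp L (- w)%C.
Proof.
  unfold cexp. destruct w as [u v]; unfold Re, Im; simpl.
  replace (u * - L) with (- u * L) by ring. replace (v * - L) with (- v * L) by ring. reflexivity.
Qed.

Lemma derivC_cexp (w : C) (L : R) : derivC (fun t => cexp t w) L (w * cexp L w)%C.
Proof.
  unfold cexp. split; simpl; unfold Re, Im; simpl; auto_derive; auto; ring.
Qed.

Lemma is_derive_pow_fact (k : nat) (t : R) :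
  is_derive (fun s => s ^ S k / INR (fact (S k))) t (t ^ k / INR (fact k)).
Proof.
  assert (E : INR (fact (S k)) = INR (S k) * INR (fact k)) by (rewrite fact_simpl; apply mult_INR).
  assert (N1 := INR_fact_neq_0 k). assert (N2 : INR (S k) <> 0) by (apply not_0_INR; lia).
  evar_last.
  - apply (is_derive_mult_R (fun s => s ^ S k) (fun _ => / INR (fact (S k)))).
    + apply (is_derive_pow (fun s => s)), is_derive_id.
    + apply @is_derive_const.
  - rewrite E. change (Nat.pred (S k)) with k. unfold one, zero; cbn -[INR fact pow]. field. auto.
Qed.

(** Induction on K: the derivative in t of the remainder of order K + 1 is w times the remainder of
    order K. The exponential factor is frozen at the right end L, so that only the power of t has to
    be integrated. *)
Lemma cexp_taylor_pos (w : C) (L : R) (K : nat) : 0 <= L -> forall t, 0 <= t <= L ->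
  Cmod (cexp t w - csum K (fun k => w ^ k * RtoC (t ^ k / INR (fact k))))%C
  <= Cmod w ^ K * (t ^ K / INR (fact K)) * exp (Cmod w * L).
Proof.
  intros HL. induction K as [|K IH]; intros t Ht.
  - simpl. replace (cexp t w - 0)%C with (cexp t w) by ring.
    rewrite Cmod_cexp. replace (1 * (1 / 1) * exp (Cmod w * L)) with (exp (Cmod w * L)) by field.
    assert (H : Re w * t <= Cmod w * L).
    { assert (A := Rabs_Re_le w). assert (B := Rle_abs (Re w)). assert (D := Cmod_ge_0 w). nra. }
    destruct H as [H|H]; [left; now apply exp_increasing|right; now rewrite H].
  - set (phi := fun s => (cexp s w - csum (S K) (fun k => w ^ k * RtoC (s ^ k / INR (fact k))))%C).
    set (phi' := fun s => (w * (cexp s w - csum K (fun k => w ^ k * RtoC (s ^ k / INR (fact k)))))%C).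
    set (g := fun s => Cmod w ^ S K * (s ^ S K / INR (fact (S K))) * exp (Cmod w * L)).
    set (g' := fun s => Cmod w ^ S K * (s ^ K / INR (fact K)) * exp (Cmod w * L)).
    assert (D1 : forall s, derivC phi s (phi' s)).
    { intros s. unfold phi, phi'.
      apply (derivC_ext (fun u => cexp u w - (1
        + csum K (fun k => w ^ S k * RtoC (u ^ S k / INR (fact (S k))))))%C).
      { intros u. rewrite csum_shift. do 3 f_equal. apply C_ext; simpl; field. }
      eapply derivC_eq.
      { apply derivC_minus; [apply derivC_cexp|].
        apply derivC_plus; [apply derivC_const|].
        refine (derivC_csum K (fun k u => w ^ S k * RtoC (u ^ S k / INR (fact (S k))))%C s
           (fun k => w ^ S k * RtoC (s ^ k / INR (fact k)))%C _).
        intros k _. apply derivC_scal, derivC_RtoC, is_derive_pow_fact. }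
      rewrite (csum_ext K (fun k => w ^ S k * RtoC (s ^ k / INR (fact k)))%C
        (fun k => w * (w ^ k * RtoC (s ^ k / INR (fact k))))%C) by (intros; simpl; ring).
      rewrite csum_scal. ring. }
    assert (D2 : forall s, is_derive g s (g' s)).
    { intros s. unfold g, g'.
      evar_last.
      { apply (is_derive_mult_R (fun s => Cmod w ^ S K * (s ^ S K / INR (fact (S K)))) (fun _ => exp (Cmod w * L))).
        - apply is_derive_scal. apply is_derive_pow_fact.
        - apply @is_derive_const. }
      unfold zero; simpl. ring. }
    (* Both the remainder and its majorant vanish at 0, so a comparison of derivatives compares the
       values at t. *)
    assert (A := Cmod_increment_le phi phi' g g' 0 t ltac:(lra) (fun s _ => D1 s) (fun s _ => D2 s)).
    assert (P0 : phi 0 = 0).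
    { unfold phi. rewrite csum_shift. rewrite csum_zero.
      - unfold cexp. rewrite !Rmult_0_r, exp_0, cos_0, sin_0. simpl.
        apply C_ext; simpl; field.
      - intros k _. rewrite pow_ne_zero by auto. unfold Rdiv; rewrite Rmult_0_l. ring. }
    assert (entire0 : g 0 = 0).
    { unfold g. rewrite pow_ne_zero by auto. unfold Rdiv. ring. }
    rewrite P0, entire0 in A. rewrite Rminus_0_r in A.
    replace (phi t - 0)%C with (phi t) in A by ring. apply A.
    intros s Hs. unfold phi', g'. rewrite Cmod_mult. simpl.
    assert (B := IH s ltac:(lra)).
    assert (D := Cmod_ge_0 w). simpl in B.
    eapply Rle_trans; [apply Rmult_le_compat_l; [exact D|exact B]|].
    right; ring.
Qed.

Lemma cexp_taylor (w : C) (L : R) (K : nat) :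
  Cmod (cexp L w - csum K (fun k => w ^ k * RtoC (L ^ k / INR (fact k))))%C
  <= Cmod w ^ K * (Rabs L ^ K / INR (fact K)) * exp (Cmod w * Rabs L).
Proof.
  destruct (Rle_lt_dec 0 L) as [h|h].
  - rewrite Rabs_right by lra. apply cexp_taylor_pos; lra.
  - rewrite Rabs_left by lra.
    assert (A := cexp_taylor_pos (- w)%C (- L) K ltac:(lra) (- L) ltac:(lra)).
    rewrite Cmod_opp in A.
    rewrite cexp_opp in A. replace (- - w)%C with w in A by ring.
    rewrite (csum_ext K _ (fun k => w ^ k * RtoC (L ^ k / INR (fact k)))%C) in A; [exact A|].
    intros k _. unfold Rdiv. rewrite !RtoC_mult, !RtoC_pow, !Cmult_assoc, <- !Cpow_mult_l.
    do 2 f_equal. rewrite RtoC_opp. ring.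
Qed.

Lemma pow_div_fact_le_exp (u : R) (k : nat) : 0 <= u -> u ^ k / INR (fact k) <= exp u.
Proof.
  intros Hu. eapply Rle_trans; [|apply (exp_ge_taylor u k Hu)].
  destruct k; [simpl; lra|].
  rewrite tech5. assert (0 <= sum_f_R0 (fun k => u ^ k / INR (fact k)) k); [|lra].
  apply cond_pos_sum. intros n. apply Rmult_le_pos; [now apply pow_le|].
  left; apply Rinv_0_lt_compat, INR_fact_lt_0.
Qed.

(* A Taylor expansion with an error bound at every order on |w| < 1 / (2 A). Unlike
   mere convergence, it passes to integrals and sums over a parameter without
   any exchange of limits. *)
Definition taylor (M A : R) (c : nat -> C) (f : C -> C) : Prop :=
  forall w : C, A * Cmod w < 1/2 -> forall K,
    Cmod (f w - csum K (fun k => c k * w ^ k))%C <= M * (A * Cmod w) ^ K.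

(** The term 2 |L| / A pays twice for exp(|L| / A): once as a bound for (|L| / A)^K / K!, once for
    the factor exp(|w| |L|), since |w| < 1 / A on the disc. *)
Lemma taylor_cexp (z : C) (L A : R) : 0 < A ->
  taylor (exp (- Re z * L + 2 * Rabs L / A)) A
    (fun k => cexp L (- z) * RtoC ((- L) ^ k / INR (fact k)))%C
    (fun w => cexp L (- (z + w)))%C.
Proof.
  intros HA w Hw K.
  assert (Hw0 := Cmod_ge_0 w). assert (HL := Rabs_pos L).
  replace (- (z + w))%C with (- z + - w)%C by ring. rewrite cexp_plus.
  rewrite (csum_ext K _ (fun k => cexp L (- z) * ((- w) ^ k * RtoC (L ^ k / INR (fact k))))%C).
  2:{ intros k _. unfold Rdiv. rewrite !RtoC_mult, !RtoC_pow.
      replace (RtoC (- L)) with ((-(1)) * RtoC L)%C by (rewrite RtoC_opp; ring).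
      replace (- w)%C with ((-(1)) * w)%C by ring.
      rewrite !Cpow_mult_l. ring. }
  rewrite csum_scal.
  match goal with |- Cmod (?a * ?b - ?a * ?d)%C <= _ =>
    replace (a * b - a * d)%C with (a * (b - d))%C by ring end.
  rewrite Cmod_mult, Cmod_cexp.
  assert (T := cexp_taylor (- w)%C L K). rewrite Cmod_opp in T.
  replace (Re (- z)%C) with (- Re z) by reflexivity.
  replace (- Re z * L + 2 * Rabs L / A) with (- Re z * L + (Rabs L / A + Rabs L / A)) by (field; lra).
  rewrite !exp_plus, !Rmult_assoc.
  apply Rmult_le_compat_l; [left; apply exp_pos|].
  eapply Rle_trans; [exact T|].
  assert (B1 : exp (Cmod w * Rabs L) <= exp (Rabs L / A)).
  { assert (H : Cmod w * Rabs L <= Rabs L / A).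
    { apply Rmult_le_reg_l with A; auto. replace (A * (Rabs L / A)) with (Rabs L) by (field; lra). nra. }
    destruct H as [H|H]; [left; now apply exp_increasing|right; now rewrite H]. }
  assert (B2 := pow_div_fact_le_exp (Rabs L / A) K
     ltac:(apply Rmult_le_pos; [auto|left; now apply Rinv_0_lt_compat])).
  replace (Cmod w ^ K * (Rabs L ^ K / INR (fact K)) * exp (Cmod w * Rabs L))
    with ((A * Cmod w) ^ K * ((Rabs L / A) ^ K / INR (fact K)) * exp (Cmod w * Rabs L)).
  2:{ rewrite !Rpow_mult_distr. unfold Rdiv. rewrite Rpow_mult_distr, pow_inv.
      field. split; [apply INR_fact_neq_0|apply pow_nonzero; lra]. }
  assert (P : 0 <= (A * Cmod w) ^ K) by (apply pow_le; nra).
  assert (Q : 0 <= (Rabs L / A) ^ K / INR (fact K)).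
  { apply Rmult_le_pos; [apply pow_le|left; apply Rinv_0_lt_compat, INR_fact_lt_0].
    apply Rmult_le_pos; [auto|left; now apply Rinv_0_lt_compat]. }
  assert (E1 := exp_pos (Cmod w * Rabs L)).
  rewrite (Rmult_comm (exp (Rabs L / A)) (exp (Rabs L / A) * _)), (Rmult_comm (exp (Rabs L / A)) ((A * Cmod w) ^ K)).
  apply Rmult_le_compat; try nra.
Qed.

Lemma taylor_nonneg (M A : R) (c : nat -> C) (f : C -> C) : taylor M A c f -> 0 <= M.
Proof.
  intros H. assert (T := H 0 ltac:(rewrite Cmod_0; lra) O). simpl in T.
  assert (B := Cmod_ge_0 (f 0 - 0)%C). lra.
Qed.

Lemma taylor_ext (M A : R) (c d : nat -> C) (f g : C -> C) :
  (forall k, c k = d k) -> (forall w, A * Cmod w < 1/2 -> f w = g w) ->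
  taylor M A c f -> taylor M A d g.
Proof.
  intros E1 E2 H w Hw K. rewrite <- E2 by auto.
  rewrite (csum_ext K _ (fun k => c k * w ^ k)%C); [now apply H|].
  intros; now rewrite E1.
Qed.

Lemma taylor_mono (M M' A A' : R) (c : nat -> C) (f : C -> C) :
  0 <= A -> M <= M' -> A <= A' -> taylor M A c f -> taylor M' A' c f.
Proof.
  intros HA HM HAA H w Hw K.
  assert (Hw0 := Cmod_ge_0 w). assert (H0 := taylor_nonneg _ _ _ _ H).
  eapply Rle_trans; [apply H; nra|].
  apply Rmult_le_compat; auto; [apply pow_le; nra|].
  apply pow_incr; nra.
Qed.

Lemma taylor_plus (M M' A : R) (c d : nat -> C) (f g : C -> C) :
  taylor M A c f -> taylor M' A d g ->
  taylor (M + M') A (fun k => c k + d k)%C (fun w => f w + g w)%C.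
Proof.
  intros H1 H2 w Hw K.
  rewrite (csum_ext K _ (fun k => c k * w ^ k + d k * w ^ k)%C) by (intros; ring).
  rewrite csum_plus.
  match goal with |- Cmod (?a + ?b - (?p + ?q))%C <= _ =>
    replace (a + b - (p + q))%C with ((a - p) + (b - q))%C by ring end.
  eapply Rle_trans; [apply Cmod_triangle|].
  rewrite Rmult_plus_distr_r. apply Rplus_le_compat; auto.
Qed.

Lemma taylor_scal (a : C) (M A : R) (c : nat -> C) (f : C -> C) :
  taylor M A c f -> taylor (Cmod a * M) A (fun k => a * c k)%C (fun w => a * f w)%C.
Proof.
  intros H w Hw K.
  rewrite (csum_ext K _ (fun k => a * (c k * w ^ k))%C) by (intros; ring).
  rewrite csum_scal. match goal with |- Cmod (?a * ?b - ?a * ?d)%C <= _ =>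
    replace (a * b - a * d)%C with (a * (b - d))%C by ring end.
  rewrite Cmod_mult, Rmult_assoc. apply Rmult_le_compat_l; [apply Cmod_ge_0|auto].
Qed.

Lemma taylor_minus (M M' A : R) (c d : nat -> C) (f g : C -> C) :
  taylor M A c f -> taylor M' A d g ->
  taylor (M + M') A (fun k => c k - d k)%C (fun w => f w - g w)%C.
Proof.
  intros H1 H2. apply (taylor_scal (-(1))%C) in H2. rewrite Cmod_m1, Rmult_1_l in H2.
  assert (H := taylor_plus _ _ _ _ _ _ _ H1 H2).
  eapply taylor_ext; [| |exact H]; intros; cbv beta; ring.
Qed.

(** A substitute for the Cauchy estimates: the k-th term is the difference of the remainders of
    orders k and k + 1, evaluated at the point 1 / (4 A). *)
Lemma taylor_coef_bound (M A : R) (c : nat -> C) (f : C -> C) (k : nat) :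
  0 < A -> taylor M A c f -> Cmod (c k) <= 2 * M * A ^ k.
Proof.
  intros HA H. assert (HM := taylor_nonneg _ _ _ _ H).
  set (t := / (4 * A)).
  assert (Ht : 0 < t) by (apply Rinv_0_lt_compat; lra).
  assert (E : A * Cmod t = 1/4).
  { rewrite Cmod_R, Rabs_right by lra. unfold t; field; lra. }
  assert (T1 := H t ltac:(rewrite E; lra) k).
  assert (T2 := H t ltac:(rewrite E; lra) (S k)).
  rewrite E in T1, T2. simpl csum in T2.
  assert (B : Cmod (c k * t ^ k)%C <= 2 * M * (1/4) ^ k).
  { replace (c k * t ^ k)%C with
      ((f t - csum k (fun k => c k * t ^ k)) + - (f t - (csum k (fun k => c k * t ^ k) + c k * t ^ k)))%C by ring.
    eapply Rle_trans; [apply Cmod_triangle|]. rewrite Cmod_opp.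
    simpl in T2. assert (P : 0 <= M * (1/4) ^ k) by (apply Rmult_le_pos; [auto|apply pow_le; lra]).
    nra. }
  rewrite Cmod_mult, Cmod_pow in B.
  assert (E2 : Cmod t = t) by (rewrite Cmod_R, Rabs_right; lra). rewrite E2 in *.
  replace (1/4) with (A * t) in B. rewrite Rpow_mult_distr in B.
  apply Rmult_le_reg_r with (t ^ k); [now apply pow_lt|]. lra.
Qed.

(** The coefficients of w f(w). *)
Definition shift_coef (c : nat -> C) (k : nat) : C := match k with O => 0 | S j => c j end.

Lemma taylor_mul_affine (a : C) (M A : R) (c : nat -> C) (f : C -> C) :
  0 < A -> taylor M A c f ->
  taylor ((Cmod a + / A) * M) A (fun k => a * c k + shift_coef c k)%C (fun w => (a + w) * f w)%C.
Proof.
  intros HA H w Hw K.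
  assert (HM := taylor_nonneg _ _ _ _ H). assert (Hw0 := Cmod_ge_0 w).
  assert (Ha := Cmod_ge_0 a).
  assert (HA' : 0 < / A) by now apply Rinv_0_lt_compat.
  rewrite (csum_ext K _ (fun k => a * (c k * w ^ k) + shift_coef c k * w ^ k)%C) by (intros; ring).
  rewrite csum_plus, csum_scal.
  (* At order K + 1 the part w f(w) uses the estimate of order K, and its factor |w| supplies the
     missing power. Order 0 has no predecessor and is estimated directly. *)
  destruct K as [|K].
  - simpl. assert (T := H w Hw O). simpl in T.
    replace ((a + w) * f w - (a * 0 + 0))%C with ((a + w) * (f w - 0))%C by ring.
    rewrite Cmod_mult, Rmult_1_r.
    rewrite Rmult_1_r in T. assert (Q := Cmod_triangle a w).
    apply Rmult_le_compat; try apply Cmod_ge_0; auto.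
    assert (Cmod w <= / A); [|lra].
    apply Rmult_le_reg_l with A; auto. rewrite Rinv_r by lra. lra.
  - assert (T1 := H w Hw (S K)). assert (T2 := H w Hw K).
    rewrite (csum_shift K (fun k => shift_coef c k * w ^ k)%C). simpl shift_coef.
    rewrite (csum_ext K (fun k => c k * w ^ S k)%C (fun k => w * (c k * w ^ k))%C) by (intros; simpl; ring).
    rewrite csum_scal.
    match goal with |- Cmod ((a + w) * f w - (a * ?p + (RtoC 0 * w ^ 0 + w * ?q)))%C <= _ =>
      replace ((a + w) * f w - (a * p + (RtoC 0 * w ^ 0 + w * q)))%C
       with (a * (f w - p) + w * (f w - q))%C by ring end.
    eapply Rle_trans; [apply Cmod_triangle|]. rewrite !Cmod_mult.
    rewrite Rmult_assoc, Rmult_plus_distr_r. apply Rplus_le_compat.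
    + apply Rmult_le_compat_l; auto.
    + eapply Rle_trans; [apply Rmult_le_compat_l; [auto|exact T2]|].
      right. simpl. field. lra.
Qed.

(* The quotient coefficients solve a e_k + e_{k-1} = c_k. *)
Fixpoint div_coef (a : C) (c : nat -> C) (k : nat) : C :=
  match k with O => (c O / a)%C | S j => ((c (S j) - div_coef a c j) / a)%C end.

Lemma div_coef_spec (a : C) (c : nat -> C) (k : nat) : a <> 0 ->
  c k = (a * div_coef a c k + shift_coef (div_coef a c) k)%C.
Proof. intros Ha. destruct k; simpl; field; auto. Qed.

(** The condition 2 <= A |a| gives 2 M / |a| <= M A, so the previous quotient coefficient
    contributes no more to the recursion than the bound on [c] does. *)
Lemma div_coef_bound (a : C) (c : nat -> C) (M A : R) (k : nat) :
  0 < A -> 0 <= M -> 2 <= A * Cmod a -> (forall j, Cmod (c j) <= M * A ^ j) ->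
  Cmod (div_coef a c k) <= 2 * M / Cmod a * A ^ k.
Proof.
  intros HA HM HAa Hc.
  assert (Ha : 0 < Cmod a) by nra.
  assert (Ha0 : a <> 0) by now apply Cmod_gt_0.
  assert (Hi : 0 < / Cmod a) by now apply Rinv_0_lt_compat.
  induction k as [|k IH]; simpl div_coef.
  - rewrite Cmod_div by auto. specialize (Hc O). simpl in *.
    apply Rmult_le_reg_r with (Cmod a); auto. unfold Rdiv. rewrite Rmult_assoc, Rinv_l by lra.
    field_simplify; lra.
  - rewrite Cmod_div by auto.
    assert (B : Cmod (c (S k) - div_coef a c k)%C <= M * A ^ S k + 2 * M / Cmod a * A ^ k).
    { eapply Rle_trans; [apply Cmod_triangle|]. rewrite Cmod_opp. apply Rplus_le_compat; auto. }
    apply Rmult_le_reg_r with (Cmod a); auto. unfold Rdiv at 1. rewrite Rmult_assoc, Rinv_l, Rmult_1_r by lra.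
    eapply Rle_trans; [exact B|].
    replace (2 * M / Cmod a * A ^ S k * Cmod a) with (2 * M * A ^ S k) by (field; lra).
    assert (2 * M / Cmod a * A ^ k <= M * A ^ S k); [|lra].
    apply Rmult_le_reg_r with (Cmod a); auto.
    replace (2 * M / Cmod a * A ^ k * Cmod a) with (M * A ^ k * 2) by (field; lra).
    simpl. replace (M * (A * A ^ k) * Cmod a) with (M * A ^ k * (A * Cmod a)) by ring.
    apply Rmult_le_compat_l; auto. apply Rmult_le_pos; auto. apply pow_le; lra.
Qed.

(** The remainder is estimated after multiplication by a + w, whose modulus is at least |a| / 2 on
    the disc. The multiplied partial sum is the partial sum of f plus one leftover term, which
    [div_coef_bound] controls; these are the two summands of the constant. *)
Lemma taylor_div_affine (a : C) (M A : R) (c : nat -> C) (f : C -> C) :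
  0 < A -> 2 <= A * Cmod a -> taylor M A c f ->
  exists M', taylor M' A (div_coef a c) (fun w => f w / (a + w))%C.
Proof.
  intros HA HAa H. exists (2 / Cmod a * (M + 4 * M / Cmod a * / A)). intros w Hw K.
  assert (HM := taylor_nonneg _ _ _ _ H). assert (Hw0 := Cmod_ge_0 w).
  assert (Ha : 0 < Cmod a) by nra.
  assert (Ha0 : a <> 0) by now apply Cmod_gt_0.
  assert (Hi : 0 < / Cmod a) by now apply Rinv_0_lt_compat.
  assert (Hlow : Cmod a / 2 <= Cmod (a + w)%C).
  { assert (Q := Cmod_triangle (a + w)%C (- w)%C). rewrite Cmod_opp in Q.
    replace (a + w + - w)%C with a in Q by ring. nra. }
  assert (Haw : (a + w)%C <> 0) by (apply Cmod_gt_0; lra).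
  set (S1 := csum K (fun k => div_coef a c k * w ^ k)%C).
  assert (E : Cmod ((a + w) * (f w / (a + w) - S1))%C <= (M + 4 * M / Cmod a * / A) * (A * Cmod w) ^ K).
  { replace ((a + w) * (f w / (a + w) - S1))%C with (f w - (a * S1 + w * S1))%C by (field; auto).
    destruct K as [|K].
    - unfold S1. simpl. assert (T := H w Hw O). simpl in T.
      replace (f w - (a * 0 + w * 0))%C with (f w - 0)%C by ring.
      assert (0 <= 4 * M / Cmod a * / A).
      { apply Rmult_le_pos; [|left; now apply Rinv_0_lt_compat]. apply Rmult_le_pos; lra. }
      lra.
    - assert (E1 : (a * S1 + w * S1 = csum (S K) (fun k => c k * w ^ k) + div_coef a c K * w ^ S K)%C).
      { unfold S1. rewrite (csum_ext (S K) (fun k => c k * w ^ k)%C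
          (fun k => a * (div_coef a c k * w ^ k) + shift_coef (div_coef a c) k * w ^ k)%C).
        2:{ intros k _. rewrite (div_coef_spec a c k) at 1 by auto. ring. }
        rewrite csum_plus, csum_scal.
        rewrite (csum_shift K (fun k => shift_coef (div_coef a c) k * w ^ k)%C). simpl shift_coef.
        rewrite (csum_ext K (fun k => div_coef a c k * w ^ S k)%C (fun k => w * (div_coef a c k * w ^ k))%C) by (intros; simpl; ring).
        rewrite csum_scal. simpl. ring. }
      rewrite E1.
      match goal with |- Cmod (?p - (?q + ?r))%C <= _ =>
        replace (p - (q + r))%C with ((p - q) + - r)%C by ring end.
      eapply Rle_trans; [apply Cmod_triangle|]. rewrite Cmod_opp, Rmult_plus_distr_r.
      apply Rplus_le_compat; [now apply H|].
      rewrite Cmod_mult, Cmod_pow.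
      assert (B := div_coef_bound a c (2 * M) A K HA ltac:(lra) HAa (fun j => taylor_coef_bound _ _ _ _ j HA H)).
      eapply Rle_trans; [apply Rmult_le_compat_r; [now apply pow_le|exact B]|].
      right. simpl. rewrite Rpow_mult_distr. field. split; lra. }
  rewrite Cmod_mult in E.
  apply Rmult_le_reg_l with (Cmod a / 2); [lra|].
  eapply Rle_trans; [apply Rmult_le_compat_r; [apply Cmod_ge_0|exact Hlow]|].
  eapply Rle_trans; [exact E|].
  right. field. split; lra.
Qed.

(** * Uniqueness of Taylor coefficients *)

Lemma small_from_linear_bound (x B : R) : 0 <= x -> 0 <= B ->
  (forall e, 0 < e -> exists t, 0 <= t < e /\ x <= B * t) -> x = 0.
Proof.
  intros Hx HB H. destruct (Req_dec x 0) as [|N]; auto. exfalso.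
  destruct (H (x / (B + 1))) as [t [Ht1 Ht2]].
  { apply Rmult_lt_0_compat; [lra|apply Rinv_0_lt_compat; lra]. }
  assert (B * t <= B * (x / (B + 1))) by (apply Rmult_le_compat_l; lra).
  assert (E : B * (x / (B + 1)) = x - x / (B + 1)) by (field; lra).
  assert (0 < x / (B + 1)) by (apply Rmult_lt_0_compat; [lra|apply Rinv_0_lt_compat; lra]).
  lra.
Qed.

(** If the coefficients below k vanish, the estimate of order k + 1 at a zero w gives |c_k| <= M
    A^(k+1) |w|, and the zeros accumulate at 0. *)
Lemma taylor_zero_coef (M A : R) (c : nat -> C) (f : C -> C) :
  0 < A -> taylor M A c f ->
  (forall e, 0 < e -> exists w, 0 < Cmod w < e /\ f w = 0) ->
  forall k, c k = 0.
Proof.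
  intros HA H Hz k. assert (HM := taylor_nonneg _ _ _ _ H).
  induction k as [k IH] using (well_founded_induction Wf_nat.lt_wf).
  apply Cmod_eq_0.
  apply small_from_linear_bound with (M * A ^ S k); [apply Cmod_ge_0| |].
  { apply Rmult_le_pos; auto. apply pow_le; lra. }
  intros e He.
  destruct (Hz (Rmin e (/ (2 * A)))) as [w [[Hw1 Hw2] Hw3]].
  { apply Rmin_glb_lt; auto. apply Rinv_0_lt_compat; lra. }
  exists (Cmod w). split; [split; [lra|eapply Rlt_le_trans; [exact Hw2|apply Rmin_l]]|].
  assert (Hw4 : A * Cmod w < 1/2).
  { assert (Cmod w < / (2 * A)) by (eapply Rlt_le_trans; [exact Hw2|apply Rmin_r]).
    replace (1/2) with (A * / (2 * A)) by (field; lra). apply Rmult_lt_compat_l; auto. }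
  assert (T := H w Hw4 (S k)). simpl csum in T.
  rewrite csum_zero in T by (intros j Hj; rewrite (IH j Hj); ring).
  rewrite Hw3 in T. replace (0 - (0 + c k * w ^ k))%C with (- (c k * w ^ k))%C in T by ring.
  rewrite Cmod_opp, Cmod_mult, Cmod_pow, Rpow_mult_distr in T.
  apply Rmult_le_reg_r with (Cmod w ^ k); [now apply pow_lt|].
  simpl in T |- *. nra.
Qed.

(** Agreement at points accumulating at 0 suffices. Passing to [Rmax A A'] puts both expansions on
    the smaller disc. *)
Lemma taylor_unique (M M' A A' : R) (c c' : nat -> C) (f f' : C -> C) :
  0 < A -> 0 < A' -> taylor M A c f -> taylor M' A' c' f' ->
  (forall e, 0 < e -> exists w, 0 < Cmod w < e /\ f w = f' w) ->
  forall k, c k = c' k.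
Proof.
  intros HA HA' H H' E k.
  apply (taylor_mono M M A (Rmax A A')) in H; [|lra|lra|apply Rmax_l].
  apply (taylor_mono M' M' A' (Rmax A A')) in H'; [|lra|lra|apply Rmax_r].
  assert (T := taylor_minus _ _ _ _ _ _ _ H H').
  assert (Z := taylor_zero_coef _ _ _ _ ltac:(eapply Rlt_le_trans; [exact HA|apply Rmax_l]) T).
  assert (c k - c' k = 0)%C.
  { apply Z. intros e He. destruct (E e He) as [w [Hw1 Hw2]]. exists w. split; auto. rewrite Hw2; ring. }
  replace (c k) with ((c k - c' k) + c' k)%C by ring. rewrite H0; ring.
Qed.

Lemma small_real (e : R) : 0 < e -> 0 < Cmod (RtoC (e / 2)) < e.
Proof. intros He. rewrite Cmod_R, Rabs_right; lra. Qed.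

Lemma taylor_unique_same (M M' A A' : R) (c c' : nat -> C) (f : C -> C) :
  0 < A -> 0 < A' -> taylor M A c f -> taylor M' A' c' f -> forall k, c k = c' k.
Proof.
  intros HA HA' H H'. apply (taylor_unique M M' A A' c c' f f); auto.
  intros e He. exists (RtoC (e / 2)). split; auto. now apply small_real.
Qed.

Lemma geom_small (M q e : R) : 0 <= q <= 1/2 -> 0 <= M -> 0 < e ->
  exists N, forall n, (N <= n)%nat -> M * q ^ n < e.
Proof.
  intros Hq HM He.
  destruct (pow_lt_1_zero q ltac:(rewrite Rabs_right; lra) (e / (M + 1))) as [N HN].
  { apply Rmult_lt_0_compat; [lra|apply Rinv_0_lt_compat; lra]. }
  exists N. intros n Hn. specialize (HN n Hn).
  rewrite Rabs_right in HN by (apply Rle_ge, pow_le; lra).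
  assert (0 <= q ^ n) by (apply pow_le; lra).
  assert ((M + 1) * q ^ n < e).
  { replace e with ((M + 1) * (e / (M + 1))) by (field; lra). apply Rmult_lt_compat_l; lra. }
  nra.
Qed.

Lemma taylor_zero_fun (M A : R) (c : nat -> C) (f : C -> C) (w : C) :
  0 < A -> taylor M A c f -> (forall k, c k = 0) -> A * Cmod w < 1/2 -> f w = 0.
Proof.
  intros HA H Hc Hw. apply Cmod_eq_0. assert (HM := taylor_nonneg _ _ _ _ H).
  assert (Hw0 := Cmod_ge_0 w).
  destruct (Req_dec (Cmod (f w)) 0) as [|N]; auto. exfalso.
  assert (P : 0 < Cmod (f w)) by (assert (Q := Cmod_ge_0 (f w)); lra).
  destruct (geom_small M (A * Cmod w) (Cmod (f w)) ltac:(split; nra) HM P) as [n Hn].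
  specialize (Hn n (Nat.le_refl n)). assert (T := H w Hw n).
  rewrite csum_zero in T by (intros; rewrite Hc; ring).
  replace (f w - 0)%C with (f w) in T by ring. lra.
Qed.

(** * Complex series and analyticity *)

Definition Cconv (s : nat -> C) (l : C) : Prop :=
  forall e, 0 < e -> exists N, forall n, (N <= n)%nat -> Cmod (s n - l)%C < e.

Lemma Cconv_ext (s t : nat -> C) (l : C) : (forall n, s n = t n) -> Cconv s l -> Cconv t l.
Proof. intros E H e He. destruct (H e He) as [N HN]. exists N. intros; rewrite <- E; auto. Qed.

Lemma Cconv_const (l : C) : Cconv (fun _ => l) l.
Proof.
  intros e He. exists O. intros. replace (l - l)%C with (RtoC 0) by ring. rewrite Cmod_0; auto.
Qed.

Lemma Cconv_plus (s t : nat -> C) (l m : C) :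
  Cconv s l -> Cconv t m -> Cconv (fun n => s n + t n)%C (l + m)%C.
Proof.
  intros H1 H2 e He.
  destruct (H1 (e/2) ltac:(lra)) as [N1 P1]. destruct (H2 (e/2) ltac:(lra)) as [N2 P2].
  exists (max N1 N2). intros n Hn.
  replace (s n + t n - (l + m))%C with ((s n - l) + (t n - m))%C by ring.
  eapply Rle_lt_trans; [apply Cmod_triangle|].
  specialize (P1 n ltac:(lia)). specialize (P2 n ltac:(lia)). lra.
Qed.

Lemma Cconv_scal (a : C) (s : nat -> C) (l : C) :
  Cconv s l -> Cconv (fun n => a * s n)%C (a * l)%C.
Proof.
  intros H e He. assert (Ha := Cmod_ge_0 a).
  destruct (H (e / (Cmod a + 1))) as [N HN].
  { apply Rmult_lt_0_compat; [lra|apply Rinv_0_lt_compat; lra]. }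
  exists N. intros n Hn. specialize (HN n Hn).
  replace (a * s n - a * l)%C with (a * (s n - l))%C by ring.
  rewrite Cmod_mult. assert (P := Cmod_ge_0 (s n - l)%C).
  replace e with ((Cmod a + 1) * (e / (Cmod a + 1))) by (field; lra).
  apply Rle_lt_trans with ((Cmod a + 1) * Cmod (s n - l)%C); [nra|].
  apply Rmult_lt_compat_l; lra.
Qed.

Lemma Cconv_minus (s t : nat -> C) (l m : C) :
  Cconv s l -> Cconv t m -> Cconv (fun n => s n - t n)%C (l - m)%C.
Proof.
  intros H1 H2. apply (Cconv_scal (-(1))%C) in H2.
  assert (H := Cconv_plus _ _ _ _ H1 H2).
  replace (l - m)%C with (l + -(1) * m)%C by ring.
  eapply Cconv_ext; [|exact H]. intros; cbv beta; ring.
Qed.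

Lemma Cconv_csum (K : nat) (s : nat -> nat -> C) (l : nat -> C) :
  (forall k, (k < K)%nat -> Cconv (fun n => s n k) (l k)) ->
  Cconv (fun n => csum K (s n)) (csum K l).
Proof.
  induction K; simpl; intros H; [apply Cconv_const|]. apply Cconv_plus; auto.
Qed.

Lemma Cconv_le (s : nat -> C) (l m : C) (B : R) :
  Cconv s l -> (forall n, Cmod (s n - m)%C <= B) -> Cmod (l - m)%C <= B.
Proof.
  intros H HB. apply Rle_plus_epsilon. intros e He.
  destruct (H e He) as [N HN]. specialize (HN N (Nat.le_refl N)).
  replace (l - m)%C with ((s N - m) + - (s N - l))%C by ring.
  eapply Rle_trans; [apply Cmod_triangle|]. rewrite Cmod_opp. specialize (HB N). lra.
Qed.

Lemma Cconv_unique (s : nat -> C) (l m : C) : Cconv s l -> Cconv s m -> l = m.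
Proof.
  intros H1 H2. assert (H := Cconv_minus _ _ _ _ H1 H2).
  assert (A := Cconv_le _ _ 0 0 H). cbv beta in A.
  assert (B : Cmod (l - m - 0)%C = 0).
  { apply Rle_antisym; [|apply Cmod_ge_0]. apply A. intros n.
    replace (s n - s n - 0)%C with (RtoC 0) by ring. rewrite Cmod_0; lra. }
  apply Cmod_eq_0 in B. replace l with ((l - m - 0) + m)%C by ring. rewrite B; ring.
Qed.

Definition Csums (a : nat -> C) (l : C) : Prop := Cconv (fun n => csum n a) l.

Lemma Csums_is_series (a : nat -> C) (l : C) :
  Csums a l <-> is_series (K := C_AbsRing) (V := C_NormedModule) a l.
Proof.
  unfold is_series. etransitivity;
    [|symmetry; apply (filterlim_locally_ball_norm (K := C_AbsRing) (U := C_NormedModule))]. split.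
  - intros H [e He]. destruct (H e He) as [N HN]. exists N. intros n Hn.
    unfold ball_norm. change (Cmod (minus (sum_n (G := C_AbelianMonoid) a n) l) < e).
    rewrite csum_sum_n. apply HN. lia.
  - intros H e He. destruct (H (mkposreal e He)) as [N HN]. exists (S N).
    intros n Hn. destruct n as [|n]; [lia|]. specialize (HN n ltac:(lia)).
    unfold ball_norm in HN. change (Cmod (minus (sum_n (G := C_AbelianMonoid) a n) l) < e) in HN.
    rewrite csum_sum_n in HN. exact HN.
Qed.

Lemma sum_n_le_Series (u : nat -> R) (n : nat) :
  (forall k, 0 <= u k) -> ex_series u -> sum_n u n <= Series u.
Proof.
  intros Hu Hex.
  apply (is_lim_seq_incr_compare (sum_n u) (Series u)).
  - exact (Series_correct _ Hex).
  - intros k. rewrite sum_Sn. unfold plus; simpl. specialize (Hu (S k)). lra.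
Qed.

Lemma Csums_bound (a : nat -> C) (u : nat -> R) (l : C) :
  (forall n, Cmod (a n) <= u n) -> ex_series u -> Csums a l -> Cmod l <= Series u.
Proof.
  intros H Hex Hl.
  assert (Hu : forall k, 0 <= u k) by (intros k; eapply Rle_trans; [apply Cmod_ge_0|apply H]).
  replace l with (l - 0)%C by ring. apply (Cconv_le _ _ _ _ Hl). intros n.
  replace (csum n a - 0)%C with (csum n a) by ring.
  destruct n as [|n].
  - simpl. rewrite Cmod_0. eapply Rle_trans; [apply (Hu O)|].
    rewrite <- (sum_O u). now apply sum_n_le_Series.
  - eapply Rle_trans; [apply (Cmod_csum_le n a u H)|]. now apply sum_n_le_Series.
Qed.

Lemma Csums_ex (a : nat -> C) (u : nat -> R) :
  (forall n, Cmod (a n) <= u n) -> ex_series u -> exists l, Csums a l.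
Proof.
  intros H Hex.
  destruct (ex_series_le (K := C_AbsRing) (V := C_CompleteNormedModule) a u H Hex) as [l Hl].
  exists l. now apply Csums_is_series.
Qed.

Definition Csum (a : nat -> C) : C := epsilon (inhabits (RtoC 0)) (Csums a).

Lemma Csum_spec (a : nat -> C) (u : nat -> R) :
  (forall n, Cmod (a n) <= u n) -> ex_series u -> Csums a (Csum a).
Proof. intros H Hex. unfold Csum. apply epsilon_spec. now apply Csums_ex with u. Qed.

Lemma Csums_tail (a : nat -> C) (l : C) (N : nat) :
  Csums a l -> Csums (fun k => a (N + k)%nat) (l - csum N a)%C.
Proof.
  intros H e He. destruct (H e He) as [M HM]. exists M. intros n Hn.
  specialize (HM (N + n)%nat ltac:(lia)). rewrite csum_split in HM.
  match goal with |- Cmod ?x < e => match type of HM with Cmod ?y < e => replace x with y by ring end end.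
  exact HM.
Qed.

Lemma Series_tail_small (u : nat -> R) (e : R) : ex_series u -> 0 < e ->
  exists N, forall n, (N <= n)%nat -> Series (fun k => u (n + k)%nat) < e.
Proof.
  intros Hex He. assert (H := Series_correct _ Hex).
  change (is_lim_seq (sum_n u) (Series u)) in H. apply is_lim_seq_spec in H.
  destruct (H (mkposreal e He)) as [N HN]. exists (S N). intros n Hn.
  destruct n as [|n]; [lia|]. specialize (HN n ltac:(lia)).
  simpl in HN.
  rewrite (Series_incr_n u (S n)) in HN by (auto; lia).
  simpl pred in HN. rewrite sum_n_Reals in HN. apply Rabs_def2 in HN. lra.
Qed.

Lemma csum_swap (N K : nat) (a : nat -> nat -> C) :
  csum N (fun n => csum K (fun k => a n k)) = csum K (fun k => csum N (fun n => a n k)).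
Proof.
  induction N; simpl; [now rewrite csum_zero|]. rewrite IHN, <- csum_plus. reflexivity.
Qed.

(** The sums over n and k are exchanged only for finitely many terms. The limit is taken for the
    whole remainder, whose terms are dominated by [Mn n] times a fixed power. *)
Lemma taylor_series (Mn : nat -> R) (A : R) (c : nat -> nat -> C) (f : nat -> C -> C) (F : C -> C) :
  0 < A -> (forall n, taylor (Mn n) A (c n) (f n)) -> ex_series Mn ->
  (forall w, A * Cmod w < 1/2 -> Csums (fun n => f n w) (F w)) ->
  taylor (Series Mn) A (fun k => Csum (fun n => c n k)) F.
Proof.
  intros HA HT Hex HF w Hw K.
  assert (Hw0 := Cmod_ge_0 w).
  assert (Hc : forall k, Csums (fun n => c n k) (Csum (fun n => c n k))).
  { intros k. apply Csum_spec with (fun n => Mn n * (2 * A ^ k)).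
    - intros n. assert (B := taylor_coef_bound _ _ _ _ k HA (HT n)). lra.
    - now apply (ex_series_scal_r (2 * A ^ k) Mn). }
  rewrite <- Series_scal_r.
  apply (Csums_bound (fun n => f n w - csum K (fun k => c n k * w ^ k))%C).
  - intros n. now apply HT.
  - now apply (ex_series_scal_r _ Mn).
  - unfold Csums.
    apply Cconv_ext with (fun N => csum N (fun n => f n w) - csum K (fun k => w ^ k * csum N (fun n => c n k)))%C.
    { intros N. rewrite csum_minus. f_equal. rewrite (csum_swap N K (fun n k => c n k * w ^ k)%C).
      apply csum_ext. intros k _. rewrite <- csum_scal. apply csum_ext. intros; ring. }
    apply Cconv_minus; [now apply HF|].
    rewrite (csum_ext K _ (fun k => w ^ k * Csum (fun n => c n k))%C) by (intros; ring).
    apply (Cconv_csum K (fun N k => w ^ k * csum N (fun n => c n k))%C). intros k _. apply Cconv_scal, Hc.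
Qed.

Lemma is_pseries_Csums (c : nat -> C) (w l : C) :
  is_pseries (K := C_AbsRing) (V := C_NormedModule) c w l <-> Csums (fun k => c k * w ^ k)%C l.
Proof.
  unfold is_pseries. rewrite <- Csums_is_series. unfold Csums.
  assert (E : forall k, (pow_n (K := C_AbsRing) w k * c k)%C = (c k * w ^ k)%C).
  { intros k. rewrite Cmult_comm. reflexivity. }
  split; intros H; (eapply Cconv_ext; [|exact H]); intros n; apply csum_ext; intros k _;
    [apply E|symmetry; apply E].
Qed.

Lemma taylor_Csums (M A : R) (c : nat -> C) (f : C -> C) (w : C) :
  0 < A -> taylor M A c f -> A * Cmod w < 1/2 -> Csums (fun k => c k * w ^ k)%C (f w).
Proof.
  intros HA H Hw e He. assert (HM := taylor_nonneg _ _ _ _ H). assert (Hw0 := Cmod_ge_0 w).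
  destruct (geom_small M (A * Cmod w) e ltac:(split; nra) HM He) as [N HN].
  exists N. intros n Hn. rewrite <- Cmod_opp.
  replace (- (csum n (fun k => c k * w ^ k) - f w))%C with (f w - csum n (fun k => c k * w ^ k))%C by ring.
  eapply Rle_lt_trans; [apply H; auto|auto].
Qed.

Lemma taylor_analytic (M A : R) (c : nat -> C) (f : C -> C) (z0 : C) :
  0 < A -> taylor M A c (fun w => f (z0 + w)%C) -> C_analytic_at f z0.
Proof.
  intros HA H. exists c, (/ (2 * A)). split; [apply Rinv_0_lt_compat; lra|].
  intros z Hz. apply is_pseries_Csums.
  replace (f z) with (f (z0 + (z - z0)))%C by (f_equal; ring).
  apply (taylor_Csums M A c (fun w => f (z0 + w)%C)); auto.
  replace (1/2) with (A * / (2 * A)) by (field; lra). now apply Rmult_lt_compat_l.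
Qed.

Lemma Cconv_bounded (s : nat -> C) (l : C) : Cconv s l -> exists B, forall n, Cmod (s n) <= B.
Proof.
  intros H. destruct (H 1 ltac:(lra)) as [N HN].
  assert (forall m, exists B, forall n, (n < m)%nat -> Cmod (s n) <= B) as P.
  { induction m as [|m [B HB]]; [exists 0; intros; lia|].
    exists (Rmax B (Cmod (s m))). intros n Hn.
    destruct (Nat.eq_dec n m) as [->|]; [apply Rmax_r|].
    eapply Rle_trans; [apply HB; lia|apply Rmax_l]. }
  destruct (P N) as [B HB]. exists (Rmax B (1 + Cmod l)). intros n.
  destruct (Nat.lt_ge_cases n N) as [h|h]; [eapply Rle_trans; [now apply HB|apply Rmax_l]|].
  eapply Rle_trans; [|apply Rmax_r].
  replace (s n) with ((s n - l) + l)%C by ring.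
  eapply Rle_trans; [apply Cmod_triangle|]. specialize (HN n h). lra.
Qed.

(** Convergence at r / 2 bounds the partial sums by some B, hence the k-th term there by 2 B, so A =
    2 / r works. The tail is geometric with ratio below 1/2; its sum at most doubles the constant to
    4 B. *)
Lemma analytic_taylor (f : C -> C) (z0 : C) :
  C_analytic_at f z0 -> exists M A c, 0 < A /\ taylor M A c (fun w => f (z0 + w)%C).
Proof.
  intros [c [r [Hr H]]].
  assert (Hc : forall w, Cmod w < r -> Csums (fun k => c k * w ^ k)%C (f (z0 + w)%C)).
  { intros w Hw. apply is_pseries_Csums.
    replace w with (z0 + w - z0)%C at 1 by ring. apply H.
    replace (z0 + w - z0)%C with w by ring. exact Hw. }
  assert (Hr2 : Cmod (RtoC (r / 2)) = r / 2) by (rewrite Cmod_R, Rabs_right; lra).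
  destruct (Cconv_bounded _ _ (Hc (RtoC (r / 2)) ltac:(lra))) as [B HB].
  assert (HB0 : 0 <= B) by (eapply Rle_trans; [apply Cmod_ge_0|apply (HB O)]).
  assert (Hck : forall k, Cmod (c k) <= 2 * B * (2 / r) ^ k).
  { intros k. apply Rmult_le_reg_r with ((r / 2) ^ k); [apply pow_lt; lra|].
    rewrite Rmult_assoc, <- Rpow_mult_distr. replace (2 / r * (r / 2)) with 1 by (field; lra).
    rewrite pow1, Rmult_1_r. rewrite <- Hr2, <- Cmod_pow, <- Cmod_mult.
    assert (B1 := HB k). assert (B2 := HB (S k)). simpl in B2.
    match type of B2 with Cmod (?p + ?q)%C <= _ =>
      replace (c k * RtoC (r / 2) ^ k)%C with ((p + q) + - p)%C by ring end.
    eapply Rle_trans; [apply Cmod_triangle|]. rewrite Cmod_opp. lra. }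
  assert (HA : 0 < 2 / r) by (apply Rmult_lt_0_compat; [lra|now apply Rinv_0_lt_compat]).
  exists (4 * B), (2 / r), c. split; auto. intros w Hw K.
  assert (Hw0 := Cmod_ge_0 w).
  assert (Hwr : Cmod w < r).
  { apply Rmult_lt_reg_l with (2 / r); auto. replace (2 / r * r) with 2 by (field; lra). lra. }
  set (th := 2 / r * Cmod w) in *.
  assert (Hth : 0 <= th) by (unfold th; nra).
  assert (Ht := Csums_tail _ _ K (Hc w Hwr)).
  assert (Hg : is_series (fun k => 2 * B * th ^ K * th ^ k) (2 * B * th ^ K * / (1 - th))).
  { apply (is_series_scal_l (2 * B * th ^ K) (fun k => th ^ k)). apply is_series_geom. rewrite Rabs_right; lra. }
  assert (Hb : Cmod (f (z0 + w)%C - csum K (fun k => c k * w ^ k))%C <= Series (fun k => 2 * B * th ^ K * th ^ k)).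
  { eapply Csums_bound; [|eexists; exact Hg|exact Ht].
    intros k. cbv beta. rewrite Cmod_mult, Cmod_pow.
    eapply Rle_trans; [apply Rmult_le_compat_r; [now apply pow_le|apply Hck]|].
    right. rewrite (Rmult_assoc (2 * B) (th ^ K)), <- pow_add. unfold th. rewrite (Rpow_mult_distr _ _ (K + k)). ring. }
  rewrite (is_series_unique _ _ Hg) in Hb.
  eapply Rle_trans; [exact Hb|].
  assert (P : 0 <= th ^ K) by now apply pow_le.
  assert (Q : / (1 - th) <= 2).
  { replace 2 with (/ (1/2)) by field. apply Rinv_le_contravar; lra. }
  assert (0 <= 2 * B * th ^ K) by (apply Rmult_le_pos; lra). nra.
Qed.

Lemma is_derive_C_eps (f : C -> C) (z0 l : C) :
  (forall e, 0 < e -> exists d, 0 < d /\ forall w, Cmod w < d ->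
     Cmod (f (z0 + w) - f z0 - w * l)%C <= e * Cmod w) ->
  is_derive (K := C_AbsRing) (V := C_NormedModule) f z0 l.
Proof.
  intros H. split; [apply is_linear_scal_l|].
  intros x Hx.
  apply (is_filter_lim_locally_unique (K := C_AbsRing) (V := AbsRing_NormedModule C_AbsRing)) in Hx.
  rewrite <- Hx. clear x Hx.
  intros [e He]. destruct (H e He) as [d [Hd Hd']].
  exists (mkposreal d Hd). intros y Hy.
  change (Cmod (y - z0)%C < d) in Hy. specialize (Hd' (y - z0)%C Hy).
  change (Cmod ((f y - f z0) - (y - z0) * l)%C <= e * Cmod (y - z0)%C).
  assert (E : forall u : C, (z0 + (u - z0))%C = u) by (intros; ring).
  rewrite E in Hd'. exact Hd'.
Qed.

(** The estimate of order 1 at w = 0 identifies the value with [c 0]; the one of order 2 is then a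
    quadratic error for the linear approximation. *)
Lemma taylor_C_derive (M A : R) (c : nat -> C) (f : C -> C) (z0 : C) :
  0 < A -> taylor M A c (fun w => f (z0 + w)%C) -> C_derive f z0 = c 1%nat.
Proof.
  intros HA H. apply is_C_derive_unique. assert (HM := taylor_nonneg _ _ _ _ H).
  apply is_derive_C_eps. intros e He.
  assert (HP : 0 < M * A ^ 2 + 1) by (assert (0 <= M * A ^ 2) by (apply Rmult_le_pos; [auto|apply pow_le; lra]); lra).
  exists (Rmin (/ (2 * A)) (e / (M * A ^ 2 + 1))). split.
  { apply Rmin_glb_lt; [apply Rinv_0_lt_compat; lra|].
    apply Rmult_lt_0_compat; [lra|now apply Rinv_0_lt_compat]. }
  intros w Hw. assert (Hw0 := Cmod_ge_0 w).
  assert (Hw1 := Rlt_le_trans _ _ _ Hw (Rmin_l _ _)).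
  assert (Hw2 := Rlt_le_trans _ _ _ Hw (Rmin_r _ _)).
  assert (Hw3 : A * Cmod w < 1/2).
  { replace (1/2) with (A * / (2 * A)) by (field; lra). now apply Rmult_lt_compat_l. }
  assert (T0 := H 0 ltac:(rewrite Cmod_0; lra) 1%nat).
  rewrite Cmod_0 in T0. simpl in T0.
  assert (E0 : f (z0 + 0)%C = c O).
  { assert (Cmod (f (z0 + 0) - (0 + c O * 1))%C = 0).
    { apply Rle_antisym; [|apply Cmod_ge_0]. eapply Rle_trans; [exact T0|]. right; ring. }
    apply Cmod_eq_0 in H0.
    replace (f (z0 + 0)%C) with ((f (z0 + 0) - (0 + c O * 1)) + c O)%C by ring. rewrite H0. ring. }
  replace (z0 + 0)%C with z0 in E0 by ring.
  assert (T := H w Hw3 2%nat). simpl csum in T. rewrite E0.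
  match type of T with Cmod ?x <= _ => replace (f (z0 + w) - c 0%nat - w * c 1%nat)%C with x by (simpl; ring) end.
  eapply Rle_trans; [exact T|]. rewrite Rpow_mult_distr.
  replace (M * (A ^ 2 * Cmod w ^ 2)) with (M * A ^ 2 * Cmod w * Cmod w) by ring.
  apply Rmult_le_compat_r; auto.
  assert ((M * A ^ 2 + 1) * Cmod w <= e).
  { replace e with ((M * A ^ 2 + 1) * (e / (M * A ^ 2 + 1))) by (field; lra).
    apply Rmult_le_compat_l; lra. }
  nra.
Qed.

(** * Integration over unit intervals *)

(** The base point 1 is arbitrary in the half-line (0, oo), the only place where the integrands are
    known to be continuous. *)
Definition prim (g : R -> C) (t : R) : C :=
  (RInt (fun s => Re (g s)) 1 t, RInt (fun s => Im (g s)) 1 t).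

Lemma is_derive_RInt_pos (g : R -> R) (t : R) :
  (forall x, 0 < x -> continuous g x) -> 0 < t -> is_derive (fun s => RInt g 1 s) t (g t).
Proof.
  intros Hg Ht.
  apply (is_derive_RInt (V := R_CompleteNormedModule) g (fun s => RInt g 1 s) 1 t); [|now apply Hg].
  apply locally_pos; auto. intros s Hs. apply (RInt_correct (V := R_CompleteNormedModule)).
  apply (ex_RInt_continuous (V := R_CompleteNormedModule)). intros z [Hz _]. apply Hg.
  eapply Rlt_le_trans; [|exact Hz]. apply Rmin_glb_lt; lra.
Qed.

Lemma prim_derivC (g : R -> C) (t : R) :
  (forall x, 0 < x -> contC g x) -> 0 < t -> derivC (prim g) t (g t).
Proof.
  intros Hg Ht. split; simpl.
  - apply (is_derive_RInt_pos (fun s => Re (g s))); auto. intros x Hx; exact (proj1 (Hg x Hx)).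
  - apply (is_derive_RInt_pos (fun s => Im (g s))); auto. intros x Hx; exact (proj2 (Hg x Hx)).
Qed.

(* In terms of iterated antiderivatives: [r] is the integral of [g] over
   [q, q+1], and [v] is the integral of [(1 - u) g (q + u)] over [u] in [0, 1]. *)
Definition is_int (g : R -> C) (q : R) (r v : C) : Prop :=
  exists P Q : R -> C,
    (forall x, 0 < x -> derivC P x (g x)) /\ (forall x, 0 < x -> derivC Q x (P x)) /\
    r = (P (q + 1)%R - P q)%C /\ v = (Q (q + 1)%R - Q q - P q)%C.

Definition unit_int (g : R -> C) (q : R) : C := (prim g (q + 1)%R - prim g q)%C.

Definition hat_int (g : R -> C) (q : R) : C :=
  (prim (prim g) (q + 1)%R - prim (prim g) q - prim g q)%C.

Lemma prim_prim_derivC (g : R -> C) (t : R) :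
  (forall x, 0 < x -> contC g x) -> 0 < t -> derivC (prim (prim g)) t (prim g t).
Proof.
  intros Hg Ht. apply prim_derivC; auto. intros x Hx.
  eapply derivC_contC. now apply prim_derivC.
Qed.

Lemma is_int_ex (g : R -> C) (q : R) :
  (forall x, 0 < x -> contC g x) -> is_int g q (unit_int g q) (hat_int g q).
Proof.
  intros Hg. exists (prim g), (prim (prim g)). split; [|split; [|split; reflexivity]]; intros x Hx.
  - exact (prim_derivC g x Hg Hx).
  - exact (prim_prim_derivC g x Hg Hx).
Qed.

Lemma is_int_plus (g h : R -> C) (q : R) (r v r' v' : C) :
  is_int g q r v -> is_int h q r' v' ->
  is_int (fun x => g x + h x)%C q (r + r')%C (v + v')%C.
Proof.
  intros [P [Q [H1 [H2 [-> ->]]]]] [P' [Q' [H1' [H2' [-> ->]]]]].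
  exists (fun x => P x + P' x)%C, (fun x => Q x + Q' x)%C. split; [|split; [|split; ring]].
  - intros; apply derivC_plus; auto.
  - intros; apply derivC_plus; auto.
Qed.

Lemma is_int_scal (a : C) (g : R -> C) (q : R) (r v : C) :
  is_int g q r v -> is_int (fun x => a * g x)%C q (a * r)%C (a * v)%C.
Proof.
  intros [P [Q [H1 [H2 [-> ->]]]]].
  exists (fun x => a * P x)%C, (fun x => a * Q x)%C. split; [|split; [|split; ring]].
  - intros; apply derivC_scal; auto.
  - intros; apply derivC_scal; auto.
Qed.

Lemma is_int_minus (g h : R -> C) (q : R) (r v r' v' : C) :
  is_int g q r v -> is_int h q r' v' ->
  is_int (fun x => g x - h x)%C q (r - r')%C (v - v')%C.
Proof.
  intros [P [Q [H1 [H2 [-> ->]]]]] [P' [Q' [H1' [H2' [-> ->]]]]].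
  exists (fun x => P x - P' x)%C, (fun x => Q x - Q' x)%C. split; [|split; [|split; ring]].
  - intros; apply derivC_minus; auto.
  - intros; apply derivC_minus; auto.
Qed.

Lemma is_int_csum (K : nat) (g : nat -> R -> C) (q : R) (r v : nat -> C) :
  (forall k, (k < K)%nat -> is_int (g k) q (r k) (v k)) ->
  is_int (fun x => csum K (fun k => g k x)) q (csum K r) (csum K v).
Proof.
  induction K; simpl; intros H.
  - exists (fun _ => 0), (fun _ => 0). split; [|split; [|split; ring]]; intros; apply derivC_const.
  - apply is_int_plus; auto.
Qed.

Lemma is_int_bound (g : R -> C) (q M : R) (r v : C) : 0 < q ->
  (forall x, q <= x <= q + 1 -> Cmod (g x) <= M) -> is_int g q r v ->
  Cmod r <= M /\ Cmod v <= M.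
Proof.
  intros Hq HM [P [Q [H1 [H2 [-> ->]]]]].
  assert (HM0 : 0 <= M) by (eapply Rle_trans; [apply Cmod_ge_0|apply (HM q); lra]).
  assert (B : forall t, q <= t <= q + 1 -> Cmod (P t - P q)%C <= M).
  { intros t Ht.
    eapply Rle_trans; [apply (Cmod_increment_le_const P g M q t ltac:(lra))|]; try nra.
    - intros; apply H1; lra.
    - intros; apply HM; lra. }
  split; [apply B; lra|].
  (* Subtracting t P(q) from Q(t) leaves the derivative P(t) - P(q), already bounded by M, and its
     increment over the interval is v. *)
  assert (D : Cmod ((Q (q + 1)%R - RtoC (q + 1)%R * P q) - (Q q - RtoC q * P q))%C <= M * ((q + 1)%R - q)).
  { apply (Cmod_increment_le_const (fun t => Q t - RtoC t * P q)%C (fun t => P t - P q)%C M q (q + 1)%R ltac:(lra)).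
    - intros x Hx. eapply derivC_eq.
      { apply derivC_minus; [apply H2; lra|]. apply derivC_mult; [|apply derivC_const].
        apply (derivC_RtoC (fun t => t)), is_derive_id. }
      cbv beta. change (RtoC one) with (RtoC 1). ring.
    - auto. }
  replace (M * (q + 1 - q)) with M in D by ring.
  match type of D with Cmod ?x <= _ => replace (Q (q + 1)%R - Q q - P q)%C with x end; auto.
  rewrite RtoC_plus. ring.
Qed.

Lemma is_int_close (g h : R -> C) (q M : R) (r v r' v' : C) : 0 < q ->
  (forall x, q <= x <= q + 1 -> Cmod (g x - h x)%C <= M) ->
  is_int g q r v -> is_int h q r' v' ->
  Cmod (r - r')%C <= M /\ Cmod (v - v')%C <= M.
Proof.
  intros Hq HM H1 H2.
  apply (is_int_bound (fun x => g x - h x)%C q M); auto. now apply is_int_minus.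
Qed.

Lemma Cmod_le_0_eq (u v : C) : Cmod (u - v)%C <= 0 -> u = v.
Proof.
  intros H. assert (E : (u - v)%C = 0).
  { apply Cmod_eq_0. apply Rle_antisym; auto. apply Cmod_ge_0. }
  replace u with ((u - v) + v)%C by ring. rewrite E. ring.
Qed.

(** Makes the values in [is_int] independent of the chosen antiderivatives, so integrals can be
    computed from explicit powers and then compared with [unit_int] and [hat_int]. *)
Lemma is_int_unique (g h : R -> C) (q : R) (r v r' v' : C) : 0 < q ->
  (forall x, q <= x <= q + 1 -> g x = h x) ->
  is_int g q r v -> is_int h q r' v' -> r = r' /\ v = v'.
Proof.
  intros Hq E H1 H2.
  destruct (is_int_close g h q 0 r v r' v' Hq) as [A B]; auto.
  - intros x Hx. rewrite E by auto. replace (h x - h x)%C with (RtoC 0) by ring. rewrite Cmod_0; lra.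
  - split; now apply Cmod_le_0_eq.
Qed.

Lemma is_int_lim (f : R -> C) (g : nat -> R -> C) (q : R) (r v : C) (rn vn : nat -> C) :
  0 < q -> is_int f q r v -> (forall n, is_int (g n) q (rn n) (vn n)) ->
  (forall e, 0 < e -> exists N, forall n, (N <= n)%nat ->
     forall x, q <= x <= q + 1 -> Cmod (g n x - f x)%C <= e) ->
  Cconv rn r /\ Cconv vn v.
Proof.
  intros Hq Hf Hg H. split; intros e He; destruct (H (e/2) ltac:(lra)) as [N HN];
    exists N; intros n Hn; specialize (HN n Hn);
    destruct (is_int_close (g n) f q (e/2) (rn n) (vn n) r v Hq HN (Hg n) Hf); lra.
Qed.

(** Differentiating the three antiderivatives in [hat_int] requires only continuity of g, so the
    weighted integral gains a derivative. *)
Lemma hat_int_derivC (g : R -> C) (q : R) : (forall x, 0 < x -> contC g x) -> 0 < q ->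
  derivC (hat_int g) q (unit_int g q - g q)%C.
Proof.
  intros Hg Hq. unfold hat_int, unit_int.
  assert (S : is_derive (fun t : R => t + 1) q 1).
  { evar_last; [apply (is_derive_plus (fun t : R => t) (fun _ => 1)); [apply is_derive_id|apply is_derive_const]|].
    unfold plus, one, zero; simpl; ring. }
  eapply derivC_eq.
  - apply derivC_minus; [apply derivC_minus|].
    + apply (derivC_comp (prim (prim g)) (fun t => t + 1) q); [|exact S].
      apply prim_prim_derivC; auto; lra.
    + now apply prim_prim_derivC.
    + now apply prim_derivC.
  - ring.
Qed.

(** The remainder is itself integrated. The interval has length 1 and the weight 1 - u is at most 1,
    so M and A survive unchanged. *)
Lemma taylor_int (M A q : R) (c : nat -> R -> C) (f : C -> R -> C) : 0 < q ->
  (forall w, A * Cmod w < 1/2 -> forall x, 0 < x -> contC (f w) x) ->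
  (forall k x, 0 < x -> contC (c k) x) ->
  (forall x, q <= x <= q + 1 -> taylor M A (fun k => c k x) (fun w => f w x)) ->
  taylor M A (fun k => unit_int (c k) q) (fun w => unit_int (f w) q) /\
  taylor M A (fun k => hat_int (c k) q) (fun w => hat_int (f w) q).
Proof.
  intros Hq Hf Hc HT.
  assert (H : forall w, A * Cmod w < 1/2 -> forall K,
    Cmod (unit_int (f w) q - csum K (fun k => unit_int (c k) q * w ^ k))%C <= M * (A * Cmod w) ^ K /\
    Cmod (hat_int (f w) q - csum K (fun k => hat_int (c k) q * w ^ k))%C <= M * (A * Cmod w) ^ K).
  { intros w Hw K.
    apply (is_int_bound (fun x => f w x - csum K (fun k => w ^ k * c k x))%C q); auto.
    - intros x Hx. rewrite (csum_ext K _ (fun k => c k x * w ^ k)%C) by (intros; ring). now apply HT.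
    - apply is_int_minus; [apply is_int_ex; auto|].
      rewrite (csum_ext K (fun k => unit_int (c k) q * w ^ k)%C (fun k => w ^ k * unit_int (c k) q)%C) by (intros; ring).
      rewrite (csum_ext K (fun k => hat_int (c k) q * w ^ k)%C (fun k => w ^ k * hat_int (c k) q)%C) by (intros; ring).
      apply (is_int_csum K (fun k x => w ^ k * c k x)%C). intros k _. apply is_int_scal, is_int_ex; auto. }
  split; intros w Hw K; now apply H.
Qed.

(** Needed before coefficients can be integrated. By induction, c_k is locally a uniform limit of
    the quotients (f(t) - sum_(j<k) c_j t^j) / t^k with t small and fixed, which are continuous. *)
Lemma contC_coef (M A x d : R) (c : nat -> R -> C) (f : C -> R -> C) : 0 < A -> 0 < d ->
  (forall w, A * Cmod w < 1/2 -> contC (f w) x) ->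
  (forall y, Rabs (y - x) < d -> taylor M A (fun k => c k y) (fun w => f w y)) ->
  forall k, contC (c k) x.
Proof.
  intros HA Hd Hf HT k.
  assert (HM : 0 <= M).
  { apply (taylor_nonneg M A (fun k => c k x) (fun w => f w x)). apply HT. rewrite Rminus_diag, Rabs_R0; auto. }
  induction k as [k IH] using (well_founded_induction Wf_nat.lt_wf).
  apply contC_of_uniform_approx. intros e He.
  set (B := M * A ^ S k).
  assert (HB : 0 <= B) by (apply Rmult_le_pos; [auto|apply pow_le; lra]).
  (* The first bound keeps t inside the disc; the second makes the approximation error B t at most
     e, even when B = 0. *)
  set (t := Rmin (/ (4 * A)) (e / (B + 1))).
  assert (Ht : 0 < t).
  { apply Rmin_glb_lt; [apply Rinv_0_lt_compat; lra|].
    apply Rmult_lt_0_compat; [lra|apply Rinv_0_lt_compat; lra]. }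
  assert (Et : Cmod (RtoC t) = t) by (rewrite Cmod_R, Rabs_right; lra).
  assert (Ht1 : A * Cmod (RtoC t) < 1/2).
  { rewrite Et. assert (t <= / (4 * A)) by apply Rmin_l.
    assert (A * t <= A * / (4 * A)) by (apply Rmult_le_compat_l; lra).
    replace (A * / (4 * A)) with (1/4) in H0 by (field; lra). lra. }
  assert (Ht0 : RtoC t <> 0) by (intros E; apply RtoC_inj in E; lra).
  exists (fun y => / RtoC t ^ k * (f (RtoC t) y - csum k (fun j => RtoC t ^ j * c j y)))%C, d.
  split; auto. split.
  - apply contC_scal, contC_minus; [now apply Hf|].
    apply (contC_csum k (fun j y => RtoC t ^ j * c j y)%C). intros j Hj. now apply contC_scal, IH.
  - intros y Hy. assert (T := HT y Hy (RtoC t) Ht1 (S k)). simpl csum in T.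
    rewrite (csum_ext k (fun j => RtoC t ^ j * c j y)%C (fun j => c j y * RtoC t ^ j)%C) by (intros; ring).
    assert (Hk : (RtoC t ^ k)%C <> 0) by now apply Cpow_nz.
    match goal with |- Cmod ?u <= _ => match type of T with Cmod ?v <= _ =>
      replace u with (- (/ RtoC t ^ k * v))%C by (field; auto) end end.
    rewrite Cmod_opp, Cmod_mult, Cmod_inv, Cmod_pow, Et by auto.
    rewrite Et in T.
    assert (Hp : 0 < t ^ k) by now apply pow_lt.
    apply Rmult_le_reg_l with (t ^ k); auto.
    rewrite <- Rmult_assoc, Rinv_r, Rmult_1_l by lra.
    eapply Rle_trans; [exact T|]. rewrite Rpow_mult_distr.
    replace (M * (A ^ S k * t ^ S k)) with (t ^ k * (B * t)) by (unfold B; simpl; ring).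
    apply Rmult_le_compat_l; [lra|].
    assert ((B + 1) * t <= e).
    { replace e with ((B + 1) * (e / (B + 1))) by (field; lra). apply Rmult_le_compat_l; [lra|apply Rmin_r]. }
    nra.
Qed.

(** * The half-plane of convergence *)

Local Notation pw := pos_Cpower.

Lemma pw_plus (x : R) (a b : C) : pw x (a + b)%C = (pw x a * pw x b)%C.
Proof. apply cexp_plus. Qed.

Lemma Cmod_pw (x : R) (w : C) : Cmod (pw x w) = exp (Re w * ln x).
Proof. apply Cmod_cexp. Qed.

Lemma pw_0 (x : R) : pw x 0 = 1.
Proof. apply cexp_0. Qed.

Lemma pw_1 (x : R) : 0 < x -> pw x 1 = x.
Proof.
  intros Hx. unfold pos_Cpower. simpl.
  rewrite Rmult_1_l, Rmult_0_l, exp_ln, cos_0, sin_0 by auto.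
  apply C_ext; simpl; ring.
Qed.

Lemma pw_INR (x : R) (k : nat) : 0 < x -> pw x (RtoC (INR k)) = RtoC (x ^ k).
Proof.
  intros Hx. induction k; [apply pw_0|].
  rewrite S_INR, RtoC_plus, pw_plus, IHk, pw_1 by auto. rewrite <- RtoC_mult. f_equal. simpl; ring.
Qed.

Lemma pw_pred (x : R) (w : C) : 0 < x -> pw x w = (RtoC x * pw x (w - 1))%C.
Proof.
  intros Hx. rewrite <- (pw_1 x) by auto. rewrite <- pw_plus. f_equal. ring.
Qed.

Lemma derivC_pw (x : R) (w : C) : 0 < x -> derivC (fun t => pw t w) x (w * pw x (w - 1))%C.
Proof.
  intros Hx. eapply derivC_eq.
  - apply (derivC_comp (fun L => cexp L w) ln x); [apply derivC_cexp|].
    apply is_derive_Reals, derivable_pt_lim_ln; exact Hx.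
  - rewrite <- pos_Cpower_cexp, (pw_pred x w) by auto.
    rewrite RtoC_inv by lra. field. intros E; apply RtoC_inj in E; lra.
Qed.

Lemma exp_le (u v : R) : u <= v -> exp u <= exp v.
Proof. intros [H|H]; [left; now apply exp_increasing|right; now rewrite H]. Qed.

Lemma ln_le_sub1 (u : R) : 0 < u -> ln u <= u - 1.
Proof. intros Hu. assert (H := exp_ineq1_le (ln u)). rewrite exp_ln in H by auto. lra. Qed.

(** * Majorants for the Hurwitz series *)

Definition zterm (s : R) (n : nat) : R := exp (- s * ln (INR n + 1)).

(** The integral comparison for sum n^(-s) without an integral: it follows from ln(y+1) - ln y >=
    1/(y+1) and exp u >= 1 + u. *)
Lemma zterm_telescope (s : R) (n : nat) : 1 < s ->
  zterm s (S n) <= zterm (s - 1) n / (s - 1) - zterm (s - 1) (S n) / (s - 1).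
Proof.
  intros Hs. unfold zterm. rewrite S_INR. assert (Hn := pos_INR n).
  set (y := INR n + 1). assert (Hy : 1 <= y) by (unfold y; lra).
  assert (D : / (y + 1) <= ln (y + 1) - ln y).
  { assert (A := ln_le_sub1 (y / (y + 1)) ltac:(apply Rmult_lt_0_compat; [lra|apply Rinv_0_lt_compat; lra])).
    unfold Rdiv in A at 1. rewrite ln_mult, ln_Rinv in A by (try apply Rinv_0_lt_compat; lra).
    replace (y / (y + 1) - 1) with (- / (y + 1)) in A by (field; lra). lra. }
  replace (- (s - 1) * ln y) with (- (s - 1) * ln (y + 1) + (s - 1) * (ln (y + 1) - ln y)) by ring.
  replace (- s * ln (y + 1)) with (- (s - 1) * ln (y + 1) + - ln (y + 1)) by ring.
  rewrite !exp_plus, exp_Ropp, exp_ln by lra.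
  set (E := exp (- (s - 1) * ln (y + 1))). assert (HE : 0 < E) by apply exp_pos.
  assert (F := exp_ineq1_le ((s - 1) * (ln (y + 1) - ln y))).
  assert (Hi : 0 < / (y + 1)) by (apply Rinv_0_lt_compat; lra).
  apply Rmult_le_reg_l with (s - 1); [lra|].
  match goal with |- _ <= (s - 1) * (E * ?X / (s - 1) - E / (s - 1)) =>
    replace ((s - 1) * (E * X / (s - 1) - E / (s - 1))) with (E * (X - 1)) by (field; lra) end.
  replace ((s - 1) * (E * / (y + 1))) with (E * ((s - 1) * / (y + 1))) by ring.
  apply Rmult_le_compat_l; [lra|].
  assert ((s - 1) * / (y + 1) <= (s - 1) * (ln (y + 1) - ln y)) by (apply Rmult_le_compat_l; lra).
  lra.
Qed.

Lemma ex_series_zterm (s : R) : 1 < s -> ex_series (zterm s).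
Proof.
  intros Hs.
  assert (P : forall n, 0 < zterm s n) by (intros; apply exp_pos).
  assert (B : forall n, sum_n (zterm s) n <=
     zterm s 0 + zterm (s - 1) 0 / (s - 1) - zterm (s - 1) n / (s - 1)).
  { induction n.
    - rewrite sum_O. lra.
    - rewrite sum_Sn. unfold plus; simpl. assert (T := zterm_telescope s n Hs). lra. }
  destruct (ex_finite_lim_seq_incr (sum_n (zterm s)) (zterm s 0 + zterm (s - 1) 0 / (s - 1))) as [l Hl].
  - intros n. rewrite sum_Sn. unfold plus; simpl. specialize (P (S n)). lra.
  - intros n. eapply Rle_trans; [apply B|].
    assert (0 < zterm (s - 1) n / (s - 1)).
    { apply Rmult_lt_0_compat; [apply exp_pos|apply Rinv_0_lt_compat; lra]. }
    lra.
  - exists l. exact Hl.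
Qed.

(** Since a <= 1, n + x >= a (n + 1). This makes the majorant of the series uniform over all x >=
    a. *)
Lemma ln_shift_ge (a x : R) (n : nat) : 0 < a <= 1 -> a <= x ->
  ln a + ln (INR n + 1) <= ln (INR n + x).
Proof.
  intros Ha Hx. assert (Hn := pos_INR n).
  rewrite <- ln_mult by lra. apply ln_le; nra.
Qed.

Lemma Cmod_pw_shift_le (a x : R) (n : nat) (z : C) : 0 < a <= 1 -> a <= x -> 0 <= Re z ->
  Cmod (pw (INR n + x) (- z)) <= exp (- Re z * ln a) * zterm (Re z) n.
Proof.
  intros Ha Hx Hz. rewrite Cmod_pw. unfold zterm. rewrite <- exp_plus. apply exp_le.
  assert (A := ln_shift_ge a x n Ha Hx). change (Re (- z)%C) with (- Re z). nra.
Qed.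

Definition zeta0 (z : C) (x : R) : C := Csum (fun n => pw (INR n + x) (- z)).

Lemma ex_series_scal_zterm (b s : R) : 1 < s -> ex_series (fun n => b * zterm s n).
Proof. intros Hs. apply (ex_series_scal_l b (zterm s)). now apply ex_series_zterm. Qed.

Lemma zeta0_spec_ge (z : C) (a x : R) : 1 < Re z -> 0 < a <= 1 -> a <= x ->
  Csums (fun n => pw (INR n + x) (- z)) (zeta0 z x).
Proof.
  intros Hz Ha Hx. apply Csum_spec with (fun n => exp (- Re z * ln a) * zterm (Re z) n).
  - intros n. apply Cmod_pw_shift_le; auto; lra.
  - now apply ex_series_scal_zterm.
Qed.

Lemma Rmin_1_pos (x : R) : 0 < x -> 0 < Rmin x 1 <= 1.
Proof. intros Hx. split; [apply Rmin_glb_lt; lra|apply Rmin_r]. Qed.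

Lemma zeta0_spec (z : C) (x : R) : 1 < Re z -> 0 < x ->
  Csums (fun n => pw (INR n + x) (- z)) (zeta0 z x).
Proof.
  intros Hz Hx. apply (zeta0_spec_ge z (Rmin x 1)); auto; [now apply Rmin_1_pos|apply Rmin_l].
Qed.

Lemma zeta0_unif (z : C) (a e : R) : 1 < Re z -> 0 < a <= 1 -> 0 < e ->
  exists N, forall n, (N <= n)%nat -> forall x, a <= x ->
    Cmod (csum n (fun n => pw (INR n + x) (- z)) - zeta0 z x)%C <= e.
Proof.
  intros Hz Ha He.
  set (u := fun n => exp (- Re z * ln a) * zterm (Re z) n).
  destruct (Series_tail_small u e) as [N HN]; auto.
  { now apply ex_series_scal_zterm. }
  exists N. intros n Hn x Hx. specialize (HN n Hn).
  assert (T := Csums_tail _ _ n (zeta0_spec_ge z a x Hz Ha Hx)).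
  rewrite <- Cmod_opp.
  match goal with |- Cmod (- (?p - ?q))%C <= _ => replace (- (p - q))%C with (q - p)%C by ring end.
  eapply Rle_trans; [|left; exact HN].
  eapply Csums_bound; [|apply (ex_series_incr_n (K := R_AbsRing) (V := R_NormedModule) u n); now apply ex_series_scal_zterm|exact T].
  intros k. apply Cmod_pw_shift_le; auto; lra.
Qed.

Lemma derivC_shift (f : R -> C) (h x : R) (l : C) : derivC f (h + x) l -> derivC (fun t => f (h + t)) x l.
Proof.
  intros H.
  assert (S : is_derive (fun t : R => h + t) x 1).
  { evar_last; [apply (is_derive_plus (fun _ => h) (fun t : R => t)); [apply is_derive_const|apply is_derive_id]|].
    unfold plus, one, zero; simpl; ring. }
  eapply derivC_eq; [apply (derivC_comp f (fun t => h + t) x l 1 H S)|]. ring.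
Qed.

Lemma derivC_pw_shift (h x : R) (w : C) : 0 < h + x ->
  derivC (fun t => pw (h + t) w) x (w * pw (h + x) (w - 1))%C.
Proof. intros H. apply (derivC_shift (fun t => pw t w)). now apply derivC_pw. Qed.

Lemma zeta0_contC (z : C) (x : R) : 1 < Re z -> 0 < x -> contC (zeta0 z) x.
Proof.
  intros Hz Hx. apply contC_of_uniform_approx. intros e He.
  destruct (zeta0_unif z (Rmin (x/2) 1) e Hz ltac:(apply Rmin_1_pos; lra) He) as [N HN].
  exists (fun x => csum N (fun n => pw (INR n + x) (- z))), (x / 2). split; [lra|split].
  - apply (contC_csum N (fun n x => pw (INR n + x) (- z))). intros k _.
    eapply derivC_contC, derivC_pw_shift. assert (H := pos_INR k). lra.
  - intros y Hy. rewrite <- Cmod_opp.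
    match goal with |- Cmod (- (?p - ?q))%C <= _ => replace (- (p - q))%C with (q - p)%C by ring end.
    apply HN; auto. apply Rabs_def2 in Hy.
    eapply Rle_trans; [apply Rmin_l|]. lra.
Qed.

(** * The recursion and its invariant *)

Definition entire0 (z : C) (x : R) : C := ((z - 1) * zeta0 z x)%C.

(* Extends a solution of the recursion to a half-plane wider by one unit. *)
Definition step (f : C -> R -> C) (z : C) (q : R) : C :=
  (pw q (1 - z) + (z - 1) * hat_int (f (z + 1)%C) q)%C.

(** The invariant of the continuation on Re z > s: continuity in q, the Raabe formula, and a Taylor
    expansion in z whose radius does not depend on q and whose constant is uniform on compact
    q-intervals. The inequality 1 <= A (Re z - s) keeps the disc inside the half-plane. *)
Definition family (s : R) (f : C -> R -> C) : Prop :=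
  forall z, s < Re z ->
    (forall x, 0 < x -> contC (f z) x) /\
    (forall q, 0 < q -> unit_int (f z) q = pw q (1 - z)) /\
    exists A c, 0 < A /\ 1 <= A * (Re z - s) /\
      forall a b, 0 < a -> exists M, forall x, a <= x <= b ->
        taylor M A (fun k => c k x) (fun w => f (z + w)%C x).

Lemma Re_plus_gt (s A : R) (z w : C) :
  0 < A -> 1 <= A * (Re z - s) -> A * Cmod w < 1/2 -> s < Re (z + w)%C.
Proof.
  intros HA H Hw. change (Re (z + w)%C) with (Re z + Re w).
  assert (B := Rabs_Re_le w). assert (D := Rle_abs (- Re w)). rewrite Rabs_Ropp in D.
  assert (- Re w <= Cmod w) by lra. nra.
Qed.

Lemma pw_antideriv (h : R) (z : C) (x : R) : 0 < h + x ->
  derivC (fun t => - pw (h + t) (1 - z))%C x ((z - 1) * pw (h + x) (- z))%C.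
Proof.
  intros H. eapply derivC_eq; [apply derivC_opp, derivC_pw_shift; exact H|].
  replace (1 - z - 1)%C with (- z)%C by ring. ring.
Qed.

Lemma is_int_pw_unit_int (q : R) (z : C) (n : nat) : 0 < q -> exists v,
  is_int (fun x => (z - 1) * pw (INR n + x) (- z))%C q
    (- (pw (INR (S n) + q) (1 - z) - pw (INR n + q) (1 - z)))%C v.
Proof.
  intros Hq. assert (Hn := pos_INR n).
  set (P := fun t => (- pw (INR n + t) (1 - z))%C).
  assert (HP : forall x, 0 < x -> derivC P x ((z - 1) * pw (INR n + x) (- z))%C).
  { intros x Hx. apply pw_antideriv. lra. }
  exists (prim P (q + 1)%R - prim P q - P q)%C, P, (prim P). split; [exact HP|split].
  - intros x Hx. apply prim_derivC; auto. intros y Hy. eapply derivC_contC, HP; auto.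
  - split; [|reflexivity]. unfold P. rewrite S_INR.
    replace (INR n + 1 + q) with (INR n + (q + 1)) by ring. ring.
Qed.

(** The factors z - 1 and z make both antiderivatives polynomial multiples of powers, with no
    division at z = 0 or z = 1. Summed over n, the differences telescope and the terms of (z - 1)
    zeta remain. *)
Lemma is_int_pw_hat_int (q : R) (z : C) (n : nat) : 0 < q -> exists r,
  is_int (fun x => (z - 1) * (z * pw (INR n + x) (- (z + 1))))%C q r
    (pw (INR (S n) + q) (1 - z) - pw (INR n + q) (1 - z) + (z - 1) * pw (INR n + q) (- z))%C.
Proof.
  intros Hq. assert (Hn := pos_INR n).
  eexists. exists (fun t => - ((z - 1) * pw (INR n + t) (- z)))%C, (fun t => pw (INR n + t) (1 - z)).
  split; [|split; [|split; [reflexivity|]]].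
  - intros x Hx. eapply derivC_eq; [apply derivC_opp, derivC_scal, derivC_pw_shift; lra|].
    replace (- z - 1)%C with (- (z + 1))%C by ring. ring.
  - intros x Hx. eapply derivC_eq; [apply derivC_pw_shift; lra|].
    replace (1 - z - 1)%C with (- z)%C by ring. ring.
  - rewrite S_INR. replace (INR n + 1 + q) with (INR n + (q + 1)) by ring. ring.
Qed.

Lemma pw_decay (q : R) (w : C) : 0 < q -> Re w < 0 -> Cconv (fun n => pw (INR n + q) w) 0.
Proof.
  intros Hq Hw e He.
  (* Since Re w < 0, exp(Re w ln(n+q)) < e as soon as ln(n+q) > ln e / Re w. *)
  destruct (nfloor_ex (exp (ln e / Re w)) ltac:(left; apply exp_pos)) as [N [_ HN]].
  exists (S N). intros n Hn. replace (pw (INR n + q) w - 0)%C with (pw (INR n + q) w) by ring.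
  rewrite Cmod_pw. rewrite <- (exp_ln e) by auto. apply exp_increasing.
  assert (H : ln e / Re w < ln (INR n + q)).
  { rewrite <- (ln_exp (ln e / Re w)). apply ln_increasing; [apply exp_pos|].
    apply le_INR in Hn. rewrite S_INR in Hn. lra. }
  apply Ropp_lt_cancel. replace (- (Re w * ln (INR n + q))) with ((- Re w) * ln (INR n + q)) by ring.
  replace (- ln e) with ((- Re w) * (ln e / Re w)) by (field; lra).
  apply Rmult_lt_compat_l; lra.
Qed.

Lemma zeta0_unif_scal (b z : C) (q : R) : 1 < Re z -> 0 < q ->
  forall e, 0 < e -> exists N, forall n, (N <= n)%nat -> forall x, q <= x <= q + 1 ->
    Cmod (csum n (fun n => b * pw (INR n + x) (- z)) - b * zeta0 z x)%C <= e.
Proof.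
  intros Hz Hq e He. assert (Hb := Cmod_ge_0 b).
  destruct (zeta0_unif z (Rmin q 1) (e / (Cmod b + 1)) Hz ltac:(now apply Rmin_1_pos)) as [N HN].
  { apply Rmult_lt_0_compat; [lra|apply Rinv_0_lt_compat; lra]. }
  exists N. intros n Hn x Hx.
  specialize (HN n Hn x ltac:(eapply Rle_trans; [apply Rmin_l|lra])).
  rewrite csum_scal.
  match goal with |- Cmod (b * ?u - b * ?v)%C <= _ => replace (b * u - b * v)%C with (b * (u - v))%C by ring end.
  rewrite Cmod_mult.
  replace e with ((Cmod b + 1) * (e / (Cmod b + 1))) by (field; lra).
  apply Rmult_le_compat; auto; try lra. apply Cmod_ge_0.
Qed.

Lemma csum_telescope_opp (n : nat) (a : nat -> C) :
  csum n (fun k => - (a (S k) - a k))%C = (a O - a n)%C.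
Proof.
  rewrite (csum_ext n _ (fun k => -(1) * (a (S k) - a k))%C) by (intros; ring).
  rewrite csum_scal, csum_telescope. ring.
Qed.

(** The unit integrals of the terms telescope, and the last power tends to 0 because Re (1 - z) <
    0. *)
Lemma entire0_unit_int (z : C) (q : R) : 1 < Re z -> 0 < q -> unit_int (entire0 z) q = pw q (1 - z).
Proof.
  intros Hz Hq.
  assert (HG : forall x, 0 < x -> contC (entire0 z) x) by (intros; now apply contC_scal, zeta0_contC).
  destruct (choice _ (fun n => is_int_pw_unit_int q z n Hq)) as [vn Hvn].
  destruct (is_int_lim (entire0 z) (fun n x => csum n (fun n => (z - 1) * pw (INR n + x) (- z))%C) q
    (unit_int (entire0 z) q) (hat_int (entire0 z) q) _ _ Hq (is_int_ex _ q HG)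
    (fun n => is_int_csum n (fun n x => (z - 1) * pw (INR n + x) (- z))%C q _ vn (fun k _ => Hvn k))
    (zeta0_unif_scal (z - 1) z q Hz Hq)) as [H _].
  eapply Cconv_unique; [exact H|].
  apply Cconv_ext with (fun n => pw (INR 0 + q) (1 - z) - pw (INR n + q) (1 - z))%C.
  { intros n. symmetry. apply (csum_telescope_opp n (fun n => pw (INR n + q) (1 - z))). }
  replace (pw q (1 - z)) with (pw (INR 0 + q) (1 - z) - 0)%C.
  2:{ simpl INR. rewrite Rplus_0_l. ring. }
  apply Cconv_minus; [apply Cconv_const|].
  apply pw_decay; auto. change (Re (1 - z)%C) with (1 - Re z). lra.
Qed.

Lemma entire0_step (z : C) (q : R) : 1 < Re z -> 0 < q -> step entire0 z q = entire0 z q.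
Proof.
  intros Hz Hq.
  assert (Hz1 : 1 < Re (z + 1)%C) by (change (Re (z + 1)%C) with (Re z + 1); lra).
  assert (HG : forall x, 0 < x -> contC (entire0 (z + 1)%C) x) by (intros; now apply contC_scal, zeta0_contC).
  assert (HI := is_int_scal (z - 1)%C _ q _ _ (is_int_ex _ q HG)).
  destruct (choice _ (fun n => is_int_pw_hat_int q z n Hq)) as [rn Hrn].
  destruct (is_int_lim _ (fun n x => csum n (fun n => (z - 1) * (z * pw (INR n + x) (- (z + 1))))%C) q
    _ _ _ _ Hq HI
    (fun n => is_int_csum n (fun n x => (z - 1) * (z * pw (INR n + x) (- (z + 1))))%C q rn _ (fun k _ => Hrn k)))
    as [_ H].
  { intros e He. destruct (zeta0_unif_scal ((z - 1) * z)%C (z + 1)%C q Hz1 Hq e He) as [N HN].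
    exists N. intros n Hn x Hx. specialize (HN n Hn x Hx).
    match goal with |- Cmod ?u <= _ => match type of HN with Cmod ?v <= _ => replace u with v end end; auto.
    f_equal; [apply csum_ext; intros; ring|]. unfold entire0. ring. }
  (* A second limit for the same partial sums: the powers telescope to -q^(1-z), and the rest is the
     series for (z - 1) zeta. *)
  assert (H' : Cconv (fun n => csum n (fun n => pw (INR (S n) + q) (1 - z) - pw (INR n + q) (1 - z)
      + (z - 1) * pw (INR n + q) (- z)))%C (0 - pw q (1 - z) + (z - 1) * zeta0 z q)%C).
  { apply Cconv_ext with (fun n => (pw (INR n + q) (1 - z) - pw (INR 0 + q) (1 - z))
       + (z - 1) * csum n (fun n => pw (INR n + q) (- z)))%C.
    { intros n. rewrite csum_plus, csum_scal. f_equal. symmetry.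
      apply (csum_telescope n (fun n => pw (INR n + q) (1 - z))). }
    apply Cconv_plus.
    - replace (pw q (1 - z)) with (pw (INR 0 + q) (1 - z)) by (simpl INR; now rewrite Rplus_0_l).
      apply Cconv_minus; [|apply Cconv_const].
      apply pw_decay; auto. change (Re (1 - z)%C) with (1 - Re z). lra.
    - apply Cconv_scal. now apply zeta0_spec. }
  assert (E := Cconv_unique _ _ _ H H').
  unfold step. rewrite E. unfold entire0. ring.
Qed.

Lemma entire0_taylor (z : C) : 1 < Re z -> exists A c, 0 < A /\ 1 <= A * (Re z - 1) /\
  forall a b, 0 < a -> exists M, forall x, a <= x <= b ->
    taylor M A (fun k => c k x) (fun w => entire0 (z + w)%C x).
Proof.
  intros Hz. set (d := Re z - 1). assert (Hd : 0 < d) by (unfold d; lra).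
  (* With this A the cost 2 |L| / A of [taylor_cexp] is (d/4) |L|. It lowers the exponent Re z only
     to s = Re z - d/4, which is still above 1. *)
  set (A := 8 / d). assert (HA : 0 < A) by (apply Rmult_lt_0_compat; [lra|now apply Rinv_0_lt_compat]).
  set (s := Re z - d / 4). assert (Hs : 1 < s) by (unfold s, d in *; lra).
  set (cn := fun x n k => (cexp (ln (INR n + x)) (- z) * RtoC ((- ln (INR n + x)) ^ k / INR (fact k)))%C).
  exists A, (fun k x => ((z - 1) * Csum (fun n => cn x n k)
     + shift_coef (fun k => Csum (fun n => cn x n k)) k))%C.
  split; [exact HA|split].
  { unfold A. fold d. replace (8 / d * d) with 8 by (field; lra). lra. }
  intros a b Ha.
  set (a1 := Rmin a 1). assert (Ha1 := Rmin_1_pos a Ha). fold a1 in Ha1.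
  assert (Hla : ln a1 <= 0) by (rewrite <- ln_1; apply ln_le; lra).
  set (K := exp (- (d / 2) * ln a1 - s * ln a1)).
  exists ((Cmod (z - 1)%C + / A) * Series (fun n => K * zterm s n)).
  intros x Hx. assert (Hx1 : a1 <= x) by (eapply Rle_trans; [apply Rmin_l|lra]).
  apply (taylor_ext _ _ (fun k => (z - 1) * Csum (fun n => cn x n k)
     + shift_coef (fun k => Csum (fun n => cn x n k)) k)%C _
     (fun w => ((z - 1) + w) * zeta0 (z + w) x)%C).
  { reflexivity. }
  { intros w _. unfold entire0. ring. }
  apply taylor_mul_affine; auto.
  apply (taylor_series (fun n => K * zterm s n) A (cn x) (fun n w => pw (INR n + x) (- (z + w)))%C); auto.
  - intros n. set (L := ln (INR n + x)).
    assert (T := taylor_cexp z L A HA). revert T. apply taylor_mono; [lra| |lra].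
    unfold K, zterm. rewrite <- exp_plus. apply exp_le.
    assert (B := ln_shift_ge a1 x n Ha1 Hx1). fold L in B.
    assert (Hn : 0 <= ln (INR n + 1)).
    { rewrite <- ln_1. apply ln_le; [lra|]. assert (H := pos_INR n). lra. }
    (* L may be negative, but never below ln a1 <= 0. *)
    assert (HL : Rabs L <= L - 2 * ln a1) by (apply Rabs_le; lra).
    replace (2 * Rabs L / A) with (d / 4 * Rabs L) by (unfold A; field; lra).
    assert (d / 4 * Rabs L <= d / 4 * (L - 2 * ln a1)) by (apply Rmult_le_compat_l; lra).
    replace (- Re z * L) with (- s * L - d / 4 * L) by (unfold s; ring).
    assert (s * (ln a1 + ln (INR n + 1)) <= s * L) by (apply Rmult_le_compat_l; lra).
    lra.
  - now apply ex_series_scal_zterm.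
  - intros w Hw. apply zeta0_spec; [|lra].
    apply (Re_plus_gt 1 A); auto. unfold A. fold d. replace (8 / d * d) with 8 by (field; lra). lra.
Qed.

Lemma entire0_family : family 1 entire0.
Proof.
  intros z Hz. split; [|split].
  - intros; now apply contC_scal, zeta0_contC.
  - intros; now apply entire0_unit_int.
  - now apply entire0_taylor.
Qed.

(** * Continuation *)

Definition taylor_loc (A : R) (c : nat -> R -> C) (f : C -> R -> C) (z : C) : Prop :=
  forall a b, 0 < a -> exists M, forall x, a <= x <= b ->
    taylor M A (fun k => c k x) (fun w => f (z + w)%C x).

Lemma family_contC (s A : R) (f : C -> R -> C) (z : C) (c : nat -> R -> C) :
  family s f -> 0 < A -> 1 <= A * (Re z - s) -> taylor_loc A c f z ->
  forall k x, 0 < x -> contC (c k) x.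
Proof.
  intros Hf HA Hs HT k x Hx.
  destruct (HT (x/2) (x+1) ltac:(lra)) as [M HM].
  apply (contC_coef M A x (Rmin (x/2) 1) c (fun w => f (z + w)%C)); auto.
  - apply Rmin_glb_lt; lra.
  - intros w Hw. apply Hf; auto. now apply (Re_plus_gt s A).
  - intros y Hy. apply HM. assert (H1 := Rmin_l (x/2) 1). assert (H2 := Rmin_r (x/2) 1).
    apply Rabs_def2 in Hy. lra.
Qed.

Definition pw_coef (z : C) (k : nat) (q : R) : C :=
  (pw q (1 - z) * RtoC ((- ln q) ^ k / INR (fact k)))%C.

(** [step] carried out on coefficients; the shifted term comes from the w in the factor z + w -
    1. *)
Definition step_coef (z : C) (c : nat -> R -> C) (k : nat) (q : R) : C :=
  (pw_coef z k q + ((z - 1) * hat_int (c k) q + shift_coef (fun j => hat_int (c j) q) k))%C.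

Lemma pw_coef_taylor (z : C) (A : R) : 0 < A -> taylor_loc A (pw_coef z) (fun z q => pw q (1 - z)) z.
Proof.
  intros HA a b Ha.
  exists (exp (Rabs (Re (z - 1)%C) * (Rabs (ln a) + Rabs (ln b)) + 2 * (Rabs (ln a) + Rabs (ln b)) / A)).
  intros x Hx.
  assert (T := taylor_cexp (z - 1)%C (ln x) A HA).
  apply (taylor_mono (exp (- Re (z - 1)%C * ln x + 2 * Rabs (ln x) / A)) _ A A); try lra.
  - apply exp_le.
    assert (B : Rabs (ln x) <= Rabs (ln a) + Rabs (ln b)).
    { assert (ln a <= ln x) by (apply ln_le; lra). assert (ln x <= ln b) by (apply ln_le; lra).
      assert (Q1 := Rle_abs (- ln a)). assert (Q2 := Rle_abs (ln b)). rewrite Rabs_Ropp in Q1.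
      assert (Q3 := Rabs_pos (ln a)). assert (Q4 := Rabs_pos (ln b)). apply Rabs_le. lra. }
    assert (D : - Re (z - 1)%C * ln x <= Rabs (Re (z - 1)%C) * Rabs (ln x)).
    { rewrite <- Rabs_mult. assert (Q := Rle_abs (- (Re (z - 1)%C * ln x))). rewrite Rabs_Ropp in Q. lra. }
    assert (E : Rabs (Re (z - 1)%C) * Rabs (ln x) <= Rabs (Re (z - 1)%C) * (Rabs (ln a) + Rabs (ln b))).
    { apply Rmult_le_compat_l; auto. apply Rabs_pos. }
    assert (F : 2 * Rabs (ln x) / A <= 2 * (Rabs (ln a) + Rabs (ln b)) / A).
    { apply Rmult_le_compat_r; [left; now apply Rinv_0_lt_compat|lra]. }
    lra.
  - revert T. apply taylor_ext.
    + intros k. unfold pw_coef. rewrite pos_Cpower_cexp. do 2 f_equal. ring.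
    + intros w _. rewrite pos_Cpower_cexp. f_equal. ring.
Qed.

Lemma taylor_loc_step (s A : R) (f : C -> R -> C) (z : C) (c : nat -> R -> C) :
  family s f -> 0 < A -> 1 <= A * (Re (z + 1)%C - s) -> taylor_loc A c f (z + 1)%C ->
  taylor_loc A (step_coef z c) (step f) z.
Proof.
  intros Hf HA Hs HT a b Ha.
  assert (Hc := family_contC s A f (z + 1)%C c Hf HA Hs HT).
  (* The integrals for q up to b reach as far as b + 1. *)
  destruct (HT a (b + 1) Ha) as [M HM].
  destruct (pw_coef_taylor z A HA a b Ha) as [M' HM'].
  exists (M' + (Cmod (z - 1)%C + / A) * M). intros q Hq.
  assert (T1 : taylor M A (fun k => hat_int (c k) q) (fun w => hat_int (f (z + 1 + w)%C) q)).
  { apply (taylor_int M A q c (fun w => f (z + 1 + w)%C)); try lra.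
    - intros w Hw. apply Hf. now apply (Re_plus_gt s A).
    - intros k x. apply Hc.
    - intros x Hx. apply HM. lra. }
  assert (T2 := taylor_plus _ _ _ _ _ _ _ (HM' q Hq) (taylor_mul_affine (z - 1)%C M A _ _ HA T1)).
  revert T2. apply taylor_ext.
  - reflexivity.
  - intros w _. unfold step. cbv beta.
    replace (z + w + 1)%C with (z + 1 + w)%C by ring. f_equal. f_equal. ring.
Qed.

(** The derivative of q^(1-z) is (1-z) q^(-z). The Raabe formula for f(z+1) turns the unit integral
    into q^(-z), which cancels it and leaves only f(z+1,q). *)
Lemma step_derivC (s : R) (f : C -> R -> C) (z : C) (q : R) :
  family s f -> s < Re (z + 1)%C -> 0 < q ->
  derivC (step f z) q (- (z - 1) * f (z + 1)%C q)%C.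
Proof.
  intros Hf Hs Hq. destruct (Hf _ Hs) as [H1 [H2 _]].
  unfold step. eapply derivC_eq.
  - apply derivC_plus; [now apply derivC_pw|]. apply derivC_scal. now apply hat_int_derivC.
  - rewrite H2 by auto. replace (1 - (z + 1))%C with (1 - z - 1)%C by ring. ring.
Qed.

(* Integration by parts turns the recursion into the Raabe formula. *)
Lemma step_unit_int (s : R) (f : C -> R -> C) (z : C) (q : R) :
  family s f -> s < Re (z + 1)%C -> 0 < q -> unit_int (step f z) q = pw q (1 - z).
Proof.
  intros Hf Hs Hq.
  assert (D := fun x => step_derivC s f z x Hf Hs).
  (* The weighted integral of one function is computed twice: here with [step f z] as
     antiderivative, and in I2 by linearity. *)
  assert (I1 : is_int (fun x => - (z - 1) * f (z + 1)%C x)%C q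
     (step f z (q + 1)%R - step f z q)%C (unit_int (step f z) q - step f z q)%C).
  { exists (step f z), (prim (step f z)). split; [exact D|split; [|split; reflexivity]].
    intros x Hx. apply prim_derivC; auto. intros y Hy. eapply derivC_contC, D, Hy. }
  assert (I2 := is_int_scal (- (z - 1))%C _ q _ _ (is_int_ex _ q (proj1 (Hf _ Hs)))).
  destruct (is_int_unique _ _ q _ _ _ _ Hq (fun x _ => eq_refl) I1 I2) as [_ E].
  replace (unit_int (step f z) q) with ((unit_int (step f z) q - step f z q) + step f z q)%C by ring.
  rewrite E. unfold step. ring.
Qed.

Lemma family_step (s : R) (f : C -> R -> C) : family s f -> family (s - 1) (step f).
Proof.
  intros Hf z Hz.
  assert (Hs : s < Re (z + 1)%C) by (change (Re (z + 1)%C) with (Re z + 1); lra).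
  split; [|split].
  - intros x Hx. eapply derivC_contC, (step_derivC s f z x Hf Hs Hx).
  - intros q Hq. now apply (step_unit_int s).
  - destruct (proj2 (proj2 (Hf _ Hs))) as [A [c [HA [HAs HT]]]].
    exists A, (step_coef z c). split; [exact HA|split].
    + change (Re (z + 1)%C) with (Re z + 1) in HAs. replace (Re z - (s - 1)) with (Re z + 1 - s) by ring. auto.
    + now apply (taylor_loc_step s).
Qed.

Lemma contC_ext_pos (f g : R -> C) (x : R) : 0 < x ->
  (forall t, 0 < t -> f t = g t) -> contC f x -> contC g x.
Proof.
  intros Hx E. rewrite !contC_eps. intros H e He. destruct (H e He) as [d [Hd Hd']].
  exists (Rmin d x). split; [now apply Rmin_glb_lt|]. intros y Hy.
  assert (H1 := Rmin_l d x). assert (H2 := Rmin_r d x).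
  rewrite <- !E; auto; [apply Hd'; lra|]. apply Rabs_def2 in Hy. lra.
Qed.

Lemma unit_int_hat_int_ext (f g : R -> C) (q : R) : 0 < q ->
  (forall x, 0 < x -> contC f x) -> (forall x, 0 < x -> f x = g x) ->
  unit_int f q = unit_int g q /\ hat_int f q = hat_int g q.
Proof.
  intros Hq Hf E.
  assert (Hg : forall x, 0 < x -> contC g x) by (intros x Hx; apply (contC_ext_pos f); auto).
  apply (is_int_unique f g q); auto using is_int_ex. intros; apply E; lra.
Qed.

Lemma family_ext (s : R) (f g : C -> R -> C) :
  (forall z x, s < Re z -> 0 < x -> f z x = g z x) -> family s f -> family s g.
Proof.
  intros E Hf z Hz. destruct (Hf z Hz) as [H1 [H2 [A [c [HA [HAs HT]]]]]].
  split; [|split].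
  - intros x Hx. apply (contC_ext_pos (f z)); auto.
  - intros q Hq. rewrite <- H2 by auto. symmetry. apply unit_int_hat_int_ext; auto.
  - exists A, c. split; [|split]; auto. intros a b Ha. destruct (HT a b Ha) as [M HM].
    exists M. intros x Hx. apply (taylor_ext _ _ (fun k => c k x) _ (fun w => f (z + w)%C x)); auto.
    intros w Hw. apply E; [now apply (Re_plus_gt s A)|lra].
Qed.

Fixpoint entireN (N : nat) : C -> R -> C := match N with O => entire0 | S M => step (entireN M) end.

Lemma entireN_family (N : nat) : family (1 - INR N) (entireN N).
Proof.
  induction N.
  - replace (1 - INR 0) with 1 by (simpl; ring). apply entire0_family.
  - rewrite S_INR. replace (1 - (INR N + 1)) with (1 - INR N - 1) by ring. now apply family_step.
Qed.

(** Each extension agrees with the previous one on the old half-plane, because [step] at z looks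
    only at z + 1. The induction starts from the recursion for the series. *)
Lemma entireN_succ (N : nat) : forall z q, 1 - INR N < Re z -> 0 < q -> entireN (S N) z q = entireN N z q.
Proof.
  induction N as [|N IH]; intros z q Hz Hq.
  - simpl in Hz. apply entire0_step; auto. lra.
  - rewrite S_INR in Hz.
    change (step (entireN (S N)) z q = step (entireN N) z q). unfold step. f_equal. f_equal.
    symmetry. apply unit_int_hat_int_ext; auto.
    + apply (entireN_family N). change (Re (z + 1)%C) with (Re z + 1). lra.
    + intros x Hx. symmetry. apply IH; auto. change (Re (z + 1)%C) with (Re z + 1). lra.
Qed.

Lemma entireN_add (N K : nat) (z : C) (q : R) : 1 - INR N < Re z -> 0 < q -> entireN (N + K) z q = entireN N z q.
Proof.
  intros Hz Hq. induction K; [now rewrite Nat.add_0_r|].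
  rewrite Nat.add_succ_r, entireN_succ; auto.
  assert (H := pos_INR K). rewrite plus_INR. lra.
Qed.

(** If the integer is not positive, [Z.to_nat] returns 0, which is right because then Re z > 1. *)
Definition level (z : C) : nat := Z.to_nat (up (1 - Re z)).

Lemma level_spec (z : C) : 1 - INR (level z) < Re z.
Proof.
  unfold level. destruct (archimed (1 - Re z)) as [H _].
  assert (E : IZR (up (1 - Re z)) <= INR (Z.to_nat (up (1 - Re z)))).
  { rewrite INR_IZR_INZ. apply IZR_le. lia. }
  lra.
Qed.

(* Entire in [z], equal to [(z - 1) * zeta(z, q)]. *)
Definition entire (z : C) (q : R) : C := entireN (level z) z q.

Lemma entire_entireN (N : nat) (z : C) (q : R) : 1 - INR N < Re z -> 0 < q -> entireN N z q = entire z q.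
Proof.
  intros Hz Hq. unfold entire. assert (Hl := level_spec z).
  rewrite <- (entireN_add N (level z) z q), <- (entireN_add (level z) N z q) by auto.
  now rewrite Nat.add_comm.
Qed.

Lemma entire_family (s : R) : family s entire.
Proof.
  assert (H : forall N, family (1 - INR N) entire).
  { intros N. apply (family_ext _ (entireN N)); [|apply entireN_family]. intros; now apply entire_entireN. }
  intros z Hz. assert (Hl := level_spec (RtoC s)). simpl in Hl.
  destruct (H (level (RtoC s)) z ltac:(lra)) as [H1 [H2 [A [c [HA [HAs HT]]]]]].
  split; [|split]; auto.
  (* The boundary s need not be the one for which A was obtained, so the disc is shrunk to fit the
     half-plane Re z > s. *)
  set (A' := Rmax A (/ (Re z - s))).
  exists A', c. split; [eapply Rlt_le_trans; [exact HA|apply Rmax_l]|split].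
  - replace 1 with (/ (Re z - s) * (Re z - s)) by (field; lra).
    apply Rmult_le_compat_r; [lra|apply Rmax_r].
  - intros a b Ha. destruct (HT a b Ha) as [M HM]. exists M. intros x Hx.
    apply (taylor_mono M M A); try lra; [apply Rmax_l|now apply HM].
Qed.

Lemma entire_step (z : C) (q : R) : 0 < q -> step entire z q = entire z q.
Proof.
  intros Hq. set (N := level (z + 1)%C). assert (Hl := level_spec (z + 1)%C). fold N in Hl.
  change (Re (z + 1)%C) with (Re z + 1) in Hl.
  rewrite <- (entire_entireN (S N) z q); [reflexivity|rewrite S_INR; lra|exact Hq].
Qed.

Lemma entire_contC (z : C) (x : R) : 0 < x -> contC (entire z) x.
Proof. apply (entire_family (Re z - 1) z). lra. Qed.

Lemma entire_unit_int (z : C) (q : R) : 0 < q -> unit_int (entire z) q = pw q (1 - z).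
Proof. apply (entire_family (Re z - 1) z). lra. Qed.

Lemma entire_derivC (z : C) (q : R) : 0 < q -> derivC (entire z) q (- (z - 1) * entire (z + 1)%C q)%C.
Proof.
  intros Hq. apply (derivC_ext_pos (step entire z)); auto using entire_step.
  apply (step_derivC (Re z)); auto using entire_family.
  change (Re (z + 1)%C) with (Re z + 1). lra.
Qed.

Lemma entire_zeta0 (z : C) (q : R) : 1 < Re z -> 0 < q -> entire z q = ((z - 1) * zeta0 z q)%C.
Proof. intros Hz Hq. rewrite <- (entire_entireN 0); auto. simpl. lra. Qed.

(** The coefficientwise form of d/dq q^(1-z-w) = -(z - 1 + w) q^(-z-w). *)
Lemma derivC_pw_coef (z : C) (k : nat) (q : R) : 0 < q ->
  derivC (pw_coef z k) q (- (z - 1) * pw_coef (z + 1) k q - shift_coef (fun j => pw_coef (z + 1) j q) k)%C.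
Proof.
  intros Hq. unfold pw_coef.
  assert (Hln : is_derive ln q (/ q)) by (apply is_derive_Reals, derivable_pt_lim_ln; exact Hq).
  assert (Hq0 : RtoC q <> 0) by (intros E; apply RtoC_inj in E; lra).
  assert (E1 : pw q (1 - (z + 1)) = (/ RtoC q * pw q (1 - z))%C).
  { rewrite (pw_pred q (1 - z)%C) by auto. replace (1 - (z + 1))%C with (1 - z - 1)%C by ring. field; auto. }
  assert (E2 : pw q (1 - z - 1) = (/ RtoC q * pw q (1 - z))%C).
  { rewrite (pw_pred q (1 - z)%C) by auto. field; auto. }
  destruct k as [|k].
  - assert (E0 : forall t, RtoC ((- ln t) ^ 0 / INR (fact 0)) = 1) by (intros; f_equal; simpl; field).
    apply (derivC_ext (fun t => pw t (1 - z))).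
    { intros t. rewrite E0. ring. }
    eapply derivC_eq; [now apply derivC_pw|].
    rewrite E0, E1, E2. simpl shift_coef. field; auto.
  - eapply derivC_eq.
    + apply derivC_mult; [now apply derivC_pw|]. apply derivC_RtoC.
      apply (is_derive_comp (fun s => s ^ S k / INR (fact (S k))) (fun s => - ln s)).
      * apply is_derive_pow_fact.
      * apply (is_derive_opp (K := R_AbsRing) (V := R_NormedModule) ln). exact Hln.
    + simpl shift_coef. rewrite E1, E2. unfold scal, opp; cbn -[INR fact pow pos_Cpower RtoC].
      unfold mult; cbn -[INR fact pow pos_Cpower RtoC].
      rewrite (RtoC_mult (- / q)), RtoC_opp, RtoC_inv by lra. field; auto.
Qed.

(* Coefficientwise form of [dG(z,q)/dq = -(z - 1) G(z + 1, q)]; the Raabe formula,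
   also taken coefficientwise, removes the unit integrals. *)
Lemma entire_coef_derivC (z : C) : exists A d c, 0 < A /\ taylor_loc A d entire z /\ taylor_loc A c entire (z + 1)%C /\
  forall k q, 0 < q -> derivC (d k) q (- (z - 1) * c k q - shift_coef (fun j => c j q) k)%C.
Proof.
  destruct (proj2 (proj2 (entire_family (Re z) (z + 1)%C
    ltac:(change (Re (z + 1)%C) with (Re z + 1); lra)))) as [A [c [HA [HAs HT]]]].
  assert (Hf := entire_family (Re z)).
  assert (Hc := family_contC _ A entire (z + 1)%C c Hf HA HAs HT).
  exists A, (step_coef z c), c. split; [exact HA|split; [|split; [exact HT|]]].
  - assert (T := taylor_loc_step _ A entire z c Hf HA HAs HT). intros a b Ha.
    destruct (T a b Ha) as [M HM]. exists M. intros x Hx.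
    eapply taylor_ext; [| |apply HM; exact Hx]; [reflexivity|].
    intros w _. apply entire_step. lra.
  - intros k q Hq.
    (* Integrating the expansion of G termwise and expanding the power directly give two expansions
       of one function, so the coefficients agree. *)
    assert (R : forall j, unit_int (c j) q = pw_coef (z + 1) j q).
    { destruct (HT q (q + 1) Hq) as [M HM].
      destruct (pw_coef_taylor (z + 1)%C A HA q q Hq) as [M' HM'].
      destruct (taylor_int M A q c (fun w => entire (z + 1 + w)%C) Hq) as [T _].
      - intros w _ x Hx. now apply entire_contC.
      - exact Hc.
      - exact HM.
      - apply (taylor_unique_same M M' A A _ _ (fun w => pw q (1 - (z + 1 + w)))); auto.
        + eapply taylor_ext; [| |exact T]; [reflexivity|]. intros w _. exact (entire_unit_int (z + 1 + w)%C q Hq).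
        + apply HM'. lra. }
    assert (Hh : forall j, derivC (hat_int (c j)) q (unit_int (c j) q - c j q)%C) by (intros; now apply hat_int_derivC; auto).
    unfold step_coef. destruct k as [|k]; simpl shift_coef.
    + eapply derivC_eq.
      * apply derivC_plus; [now apply derivC_pw_coef|]. apply derivC_plus; [apply derivC_scal, Hh|apply derivC_const].
      * simpl shift_coef. rewrite R. ring.
    + eapply derivC_eq.
      * apply derivC_plus; [now apply derivC_pw_coef|]. apply derivC_plus; [apply derivC_scal, Hh|apply Hh].
      * simpl shift_coef. rewrite !R. ring.
Qed.

(** * Uniqueness of the Hurwitz zeta function *)

Lemma entire_taylor (z : C) (q : R) : 0 < q -> exists M A c, 0 < A /\ taylor M A c (fun w => entire (z + w)%C q).
Proof.
  intros Hq. destruct (proj2 (proj2 (entire_family (Re z - 1) z ltac:(lra)))) as [A [c [HA [_ HT]]]].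
  destruct (HT q q Hq) as [M HM]. exists M, A, (fun k => c k q). split; auto. apply HM; lra.
Qed.

Lemma Csub_neq0 (u v : C) : u <> v -> (u - v)%C <> 0.
Proof. intros H E. apply H. replace u with ((u - v) + v)%C by ring. rewrite E. ring. Qed.

(** Supplies the existence without which the [epsilon] in [Hurwitz_zeta] would say nothing. *)
Lemma entire_is_Hurwitz_zeta (q : R) : 0 < q -> is_Hurwitz_zeta q (fun z => entire z q / (z - 1))%C.
Proof.
  intros Hq. split.
  - intros z Hz. apply Csums_is_series. rewrite entire_zeta0 by auto.
    assert (N : (z - 1)%C <> 0).
    { apply Csub_neq0. intros ->. simpl in Hz. lra. }
    replace ((z - 1) * zeta0 z q / (z - 1))%C with (zeta0 z q) by (field; auto).
    now apply zeta0_spec.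
  - intros z Hz. apply Csub_neq0 in Hz. assert (P := proj1 (Cmod_gt_0 _) Hz).
    destruct (entire_taylor z q Hq) as [M [A [c [HA HT]]]].
    (* Shrinks the disc so that [taylor_div_affine] applies and the zero of the denominator stays
       outside. *)
    set (A' := Rmax A (2 / Cmod (z - 1)%C)).
    assert (HA' : 0 < A') by (eapply Rlt_le_trans; [exact HA|apply Rmax_l]).
    apply (taylor_mono M M A A') in HT; [|lra|lra|apply Rmax_l].
    apply (taylor_div_affine (z - 1)%C) in HT; auto.
    + destruct HT as [M' HT]. apply (taylor_analytic M' A' (div_coef (z - 1) c)); auto.
      revert HT. apply taylor_ext; [reflexivity|]. intros w _. f_equal. ring.
    + replace 2 with (2 / Cmod (z - 1)%C * Cmod (z - 1)%C) at 1 by (field; lra).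
      apply Rmult_le_compat_r; [lra|apply Rmax_r].
Qed.

(** Let T be the supremum of the parameters up to which D vanishes. Zeros accumulate at T from
    below, so the expansion there is zero and D vanishes on a ball around that point. Unless T = 1,
    this carries the zeros beyond T. Vanishing on a whole ball at the end is what later transfers
    derivatives. *)
Lemma identity_on_segment (D : C -> C) (p v : C) : v <> 0 ->
  (forall t, 0 <= t <= 1 -> exists M A c, 0 < A /\ taylor M A c (fun w => D (p + RtoC t * v + w)%C)) ->
  (exists r, 0 < r /\ forall w, Cmod w < r -> D (p + w)%C = 0) ->
  exists r, 0 < r /\ forall w, Cmod w < r -> D (p + v + w)%C = 0.
Proof.
  intros Hv HT [r [Hr Hp]]. assert (Hv0 := proj1 (Cmod_gt_0 _) Hv).
  set (E := fun t => 0 <= t <= 1 /\ forall s, 0 <= s <= t -> D (p + RtoC s * v)%C = 0).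
  set (t0 := Rmin 1 (r / (2 * Cmod v))).
  assert (Ht0 : 0 < t0).
  { apply Rmin_glb_lt; [lra|]. apply Rmult_lt_0_compat; [lra|apply Rinv_0_lt_compat; lra]. }
  assert (Et0 : E t0).
  { split; [split; [lra|apply Rmin_l]|]. intros s Hs. apply Hp.
    rewrite Cmod_mult, Cmod_R, Rabs_right by lra.
    apply Rle_lt_trans with (r / (2 * Cmod v) * Cmod v).
    - apply Rmult_le_compat_r; [lra|]. eapply Rle_trans; [apply Hs|apply Rmin_r].
    - replace (r / (2 * Cmod v) * Cmod v) with (r / 2) by (field; lra). lra. }
  destruct (completeness E) as [T [HT1 HT2]].
  { exists 1. intros t Ht. apply Ht. }
  { now exists t0. }
  assert (HTpos : 0 < T) by (apply Rlt_le_trans with t0; auto).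
  assert (HTle : T <= 1) by (apply HT2; intros t Ht; apply Ht).
  assert (Hbelow : forall s, 0 <= s < T -> D (p + RtoC s * v)%C = 0).
  { intros s Hs. destruct (excluded_middle_informative (exists t, E t /\ s < t)) as [[t [Ht Hst]]|N].
    - apply Ht. lra.
    - exfalso. assert (T <= s); [|lra]. apply HT2. intros t Ht.
      destruct (Rle_lt_dec t s) as [|h]; auto. exfalso. apply N. now exists t. }
  destruct (HT T ltac:(lra)) as [M [A [c [HA HTS]]]].
  assert (Hc : forall k, c k = 0).
  { apply (taylor_zero_coef M A c _ HA HTS). intros e He.
    set (dl := Rmin T (e / (2 * Cmod v))).
    assert (Hdl : 0 < dl).
    { apply Rmin_glb_lt; auto. apply Rmult_lt_0_compat; [lra|apply Rinv_0_lt_compat; lra]. }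
    exists (- RtoC dl * v)%C. rewrite Cmod_mult, Cmod_opp, Cmod_R, Rabs_right by lra.
    split; [split|].
    - now apply Rmult_lt_0_compat.
    - apply Rle_lt_trans with (e / (2 * Cmod v) * Cmod v).
      + apply Rmult_le_compat_r; [lra|apply Rmin_r].
      + replace (e / (2 * Cmod v) * Cmod v) with (e / 2) by (field; lra). lra.
    - replace (p + RtoC T * v + - RtoC dl * v)%C with (p + RtoC (T - dl) * v)%C by (rewrite RtoC_minus; ring).
      apply Hbelow. split; [|lra]. assert (dl <= T) by apply Rmin_l. lra. }
  assert (Hball : forall w, Cmod w < / (2 * A) -> D (p + RtoC T * v + w)%C = 0).
  { intros w Hw. apply (taylor_zero_fun M A c (fun w => D (p + RtoC T * v + w)%C)); auto.
    replace (1/2) with (A * / (2 * A)) by (field; lra). now apply Rmult_lt_compat_l. }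
  assert (HT1' : T = 1).
  { destruct (Req_dec T 1) as [|N]; auto. exfalso.
    (* Moves at most half the radius 1 / (2 A) of the ball, without leaving the segment. *)
    set (eta := Rmin (1 - T) (/ (4 * A) / Cmod v)).
    assert (Heta : 0 < eta).
    { apply Rmin_glb_lt; [lra|]. apply Rmult_lt_0_compat; apply Rinv_0_lt_compat; lra. }
    assert (He1 : eta <= 1 - T) by apply Rmin_l.
    assert (EE : E (T + eta)).
    { split; [lra|]. intros s Hs. destruct (Rlt_le_dec s T) as [h|h]; [apply Hbelow; lra|].
      replace (p + RtoC s * v)%C with (p + RtoC T * v + RtoC (s - T) * v)%C by (rewrite RtoC_minus; ring).
      apply Hball. rewrite Cmod_mult, Cmod_R, Rabs_right by lra.
      apply Rle_lt_trans with (/ (4 * A) / Cmod v * Cmod v).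
      - apply Rmult_le_compat_r; [lra|]. apply Rle_trans with eta; [lra|apply Rmin_r].
      - replace (/ (4 * A) / Cmod v * Cmod v) with (/ (4 * A)) by (field; lra).
        apply Rinv_lt_contravar; nra. }
    specialize (HT1 _ EE). lra. }
  exists (/ (2 * A)). split; [apply Rinv_0_lt_compat; lra|]. intros w Hw.
  replace (p + v + w)%C with (p + RtoC T * v + w)%C; [now apply Hball|]. rewrite HT1'. ring.
Qed.

Lemma is_Hurwitz_zeta_unique (q : R) (Z1 Z2 : C -> C) (m : nat) : (1 <= m)%nat ->
  is_Hurwitz_zeta q Z1 -> is_Hurwitz_zeta q Z2 ->
  exists r, 0 < r /\ forall w, Cmod w < r ->
    Z1 (RtoC (1 - INR m) + w)%C = Z2 (RtoC (1 - INR m) + w)%C.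
Proof.
  intros Hm [S1 A1] [S2 A2].
  apply le_INR in Hm. simpl in Hm.
  (* The segment from 2 + i to the real point 1 - m avoids the pole. *)
  set (p := (2, 1) : C). set (z0 := RtoC (1 - INR m)). set (v := (z0 - p)%C).
  destruct (identity_on_segment (fun z => Z1 z - Z2 z)%C p v) as [r [Hr H]].
  - intros E. apply (f_equal Im) in E. unfold v, z0, p in E. simpl in E. lra.
  - intros t Ht.
    (* The imaginary part is 1 - t, which vanishes only at the endpoint 1 - m. *)
    assert (N : (p + RtoC t * v)%C <> 1).
    { intros E. assert (E1 := f_equal Im E). assert (E2 := f_equal Re E).
      unfold v, z0, p in E1, E2. simpl in E1, E2.
      assert (t = 1) by lra. subst t. lra. }
    destruct (analytic_taylor _ _ (A1 _ N)) as [M1 [B1 [c1 [HB1 T1]]]].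
    destruct (analytic_taylor _ _ (A2 _ N)) as [M2 [B2 [c2 [HB2 T2]]]].
    exists (M1 + M2), (Rmax B1 B2), (fun k => c1 k - c2 k)%C.
    split; [eapply Rlt_le_trans; [exact HB1|apply Rmax_l]|].
    apply taylor_minus.
    + revert T1. apply taylor_mono; [lra|lra|apply Rmax_l].
    + revert T2. apply taylor_mono; [lra|lra|apply Rmax_r].
  - exists 1. split; [lra|]. intros w Hw.
    assert (Hz : 1 < Re (p + w)%C).
    { change (Re (p + w)%C) with (2 + Re w).
      assert (Q := Rabs_Re_le w). assert (Q' := Rle_abs (- Re w)). rewrite Rabs_Ropp in Q'. lra. }
    assert (E : Z1 (p + w)%C = Z2 (p + w)%C).
    { eapply Cconv_unique; apply Csums_is_series; [apply S1|apply S2]; auto. }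
    rewrite E. ring.
  - exists r. split; auto. intros w Hw. specialize (H w Hw).
    replace (p + v + w)%C with (z0 + w)%C in H by (unfold v; ring).
    replace (Z1 (z0 + w)%C) with ((Z1 (z0 + w) - Z2 (z0 + w)) + Z2 (z0 + w))%C by ring.
    rewrite H. ring.
Qed.

Definition entire_der (m : nat) (q : R) : C := C_derive (fun z => entire z q) (RtoC (1 - INR m)).

Lemma taylor_value (M A : R) (c : nat -> C) (f : C -> C) : taylor M A c f -> f 0 = c O.
Proof.
  intros H. assert (T := H 0 ltac:(rewrite Cmod_0; lra) 1%nat).
  rewrite Cmod_0 in T. simpl in T. apply Cmod_le_0_eq.
  replace (f 0 - c O)%C with (f 0 - (0 + c O * 1))%C by ring.
  eapply Rle_trans; [exact T|]. right; ring.
Qed.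

(** The quotient rule at z - 1 = -m, read off from [div_coef]: zeta' = -G'/m - G/m^2. *)
Lemma A_neg_entire (m : nat) (q : R) : (1 <= m)%nat -> 0 < q ->
  A_neg m q = (- entire_der m q - RtoC (/ INR m) * entire (RtoC (1 - INR m)) q)%C.
Proof.
  intros Hm Hq. assert (Hm' := Hm). apply le_INR in Hm'. simpl in Hm'.
  set (z0 := RtoC (1 - INR m)).
  assert (HZ : is_Hurwitz_zeta q (fun z => Hurwitz_zeta z q)).
  { unfold Hurwitz_zeta.
    apply (epsilon_spec (inhabits (fun _ : C => RtoC 0)) (is_Hurwitz_zeta q)).
    eexists. now apply entire_is_Hurwitz_zeta. }
  destruct (is_Hurwitz_zeta_unique q _ _ m Hm HZ (entire_is_Hurwitz_zeta q Hq)) as [r [Hr HE]].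
  fold z0 in HE.
  destruct (entire_taylor z0 q Hq) as [M [A [c [HA HT]]]].
  assert (E1 : entire_der m q = c 1%nat) by exact (taylor_C_derive M A c (fun z => entire z q) z0 HA HT).
  assert (E0 : entire z0 q = c O).
  { rewrite <- (taylor_value M A c _ HT). f_equal. ring. }
  set (al := (z0 - 1)%C).
  assert (Eal : al = RtoC (- INR m)) by (unfold al, z0; rewrite RtoC_minus, RtoC_opp; ring).
  assert (Hal : Cmod al = INR m) by (rewrite Eal, Cmod_R, Rabs_Ropp, Rabs_right; lra).
  (* The 2 allows the division, because |z - 1| = m >= 1; 1 / r keeps the disc where both
     continuations are known to agree. *)
  set (A' := Rmax (Rmax A 2) (/ r)).
  assert (HA1 : A <= A') by (eapply Rle_trans; [apply (Rmax_l A 2)|apply Rmax_l]).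
  assert (HA2 : 2 <= A') by (eapply Rle_trans; [apply (Rmax_r A 2)|apply Rmax_l]).
  assert (HA3 : / r <= A') by apply Rmax_r.
  apply (taylor_mono M M A A') in HT; [|lra|lra|auto].
  apply (taylor_div_affine al) in HT; [|lra|rewrite Hal; nra].
  destruct HT as [M' HT].
  assert (HD : C_derive (fun z => Hurwitz_zeta z q) z0 = div_coef al c 1).
  { apply (taylor_C_derive M' A'); [lra|]. revert HT. apply taylor_ext; [reflexivity|].
    intros w Hw. rewrite HE.
    - f_equal. unfold al. ring.
    - assert (Hw0 := Cmod_ge_0 w). assert (B : / r * Cmod w < 1) by nra.
      apply Rmult_lt_reg_l with (/ r); [now apply Rinv_0_lt_compat|]. rewrite Rinv_l; lra. }
  unfold A_neg. fold z0. rewrite HD, E1, E0. simpl div_coef. rewrite Eal, RtoC_opp, RtoC_inv by lra.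
  field. intros E; apply RtoC_inj in E; lra.
Qed.

(** * Bernoulli polynomials *)

(** To be identified with B_j(q) / j!. *)
Definition bernC (j : nat) (q : R) : C := (RtoC (/ INR (fact j)) * entire (RtoC (1 - INR j)) q)%C.

Lemma RtoC_1_minus_S (k : nat) : (RtoC (1 - INR (S k)) + 1)%C = RtoC (1 - INR k).
Proof. rewrite <- RtoC_plus, S_INR. f_equal. ring. Qed.

Lemma bernC_derivC (j : nat) (q : R) : 0 < q -> derivC (bernC (S j)) q (bernC j q).
Proof.
  intros Hq. unfold bernC. eapply derivC_eq; [apply derivC_scal, entire_derivC; exact Hq|].
  rewrite RtoC_1_minus_S.
  replace (- (RtoC (1 - INR (S j)) - 1))%C with (RtoC (INR (S j))).
  2:{ rewrite RtoC_minus. ring. }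
  rewrite Cmult_assoc, <- RtoC_mult. do 2 f_equal.
  rewrite fact_simpl, mult_INR. field. split; [apply INR_fact_neq_0|apply not_0_INR; lia].
Qed.

Lemma bernC_0 (q : R) : 0 < q -> bernC 0 q = 1.
Proof.
  intros Hq. unfold bernC. rewrite <- entire_step by auto. unfold step.
  replace (RtoC (1 - INR 0)) with (RtoC 1) by (f_equal; simpl; ring).
  replace (1 - 1)%C with (RtoC 0) by ring. rewrite pw_0.
  replace (RtoC (/ INR (fact 0))) with (RtoC 1) by (f_equal; simpl; field). ring.
Qed.

Lemma bernC_contC (j : nat) (q : R) : 0 < q -> contC (bernC j) q.
Proof. intros Hq. apply contC_scal. now apply entire_contC. Qed.

(** The Raabe formula at z = 1 - j. With [bernC_derivC] it determines the sequence: the derivative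
    fixes each term up to a constant, the integral fixes the constant. *)
Lemma bernC_int (j : nat) (q : R) : 0 < q ->
  is_int (bernC j) q (RtoC (q ^ j / INR (fact j))) (hat_int (bernC j) q).
Proof.
  intros Hq. assert (H := is_int_ex (bernC j) q (fun x Hx => bernC_contC j x Hx)).
  assert (H2 := is_int_scal (RtoC (/ INR (fact j))) _ q _ _ (is_int_ex (entire (RtoC (1 - INR j))) q (fun x Hx => entire_contC _ x Hx))).
  rewrite entire_unit_int in H2 by auto.
  replace (1 - RtoC (1 - INR j))%C with (RtoC (INR j)) in H2 by (rewrite RtoC_minus; ring).
  rewrite pw_INR, <- RtoC_mult in H2 by auto.
  replace (q ^ j / INR (fact j)) with (/ INR (fact j) * q ^ j) by (unfold Rdiv; ring).
  destruct (is_int_unique _ _ q _ _ _ _ Hq (fun x _ => eq_refl) H H2) as [E _].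
  rewrite <- E. exact H.
Qed.

(* [bern_conv_eq] is the scaled form of [sum_(j <= k) 'C(k+1, j) B_j(q) = (k+1) q^k]. *)
Definition bern_conv (k : nat) (q : R) : C :=
  csum (S k) (fun j => RtoC (/ INR (fact (S k - j))) * bernC j q)%C.

Lemma bern_conv_derivC (k : nat) (q : R) : 0 < q -> derivC (bern_conv (S k)) q (bern_conv k q).
Proof.
  intros Hq. unfold bern_conv.
  apply (derivC_ext (fun x => RtoC (/ INR (fact (S (S k)))) * bernC 0 x
     + csum (S k) (fun j => RtoC (/ INR (fact (S k - j))) * bernC (S j) x))%C).
  { intros t. symmetry. apply csum_shift. }
  eapply derivC_eq.
  - apply derivC_plus.
    + apply derivC_scal. apply (derivC_ext_pos (fun _ => 1)); [auto|intros; now rewrite bernC_0|apply derivC_const].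
    + apply (derivC_csum (S k) (fun j x => RtoC (/ INR (fact (S k - j))) * bernC (S j) x)%C q
        (fun j => RtoC (/ INR (fact (S k - j))) * bernC j q)%C).
      intros j _. now apply derivC_scal, bernC_derivC.
  - ring.
Qed.

Lemma csum_RtoC (u : nat -> R) (n : nat) : csum (S n) (fun j => RtoC (u j)) = RtoC (sum_f_R0 u n).
Proof.
  induction n; [simpl; ring|].
  change (csum (S (S n)) (fun j => RtoC (u j))) with (csum (S n) (fun j => RtoC (u j)) + RtoC (u (S n)))%C.
  rewrite IHn, <- RtoC_plus. reflexivity.
Qed.

Lemma binomial_div_fact (q : R) (k : nat) :
  sum_f_R0 (fun j => / INR (fact (S k - j)) * (q ^ j / INR (fact j))) k
  = ((q + 1) ^ S k - q ^ S k) / INR (fact (S k)).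
Proof.
  assert (F := INR_fact_neq_0).
  rewrite binomial, tech5, C_n_n, Nat.sub_diag.
  rewrite (sum_eq _ (fun j => Binomial.C (S k) j * q ^ j * 1 ^ (S k - j) * / INR (fact (S k)))).
  - rewrite <- scal_sum. simpl (1 ^ 0). field. auto.
  - intros j Hj. unfold Binomial.C. rewrite pow1. field. auto.
Qed.

Lemma bern_conv_eq (k : nat) (q : R) : 0 < q -> bern_conv k q = RtoC (q ^ k / INR (fact k)).
Proof.
  revert q. induction k as [|k IH]; intros q Hq.
  - unfold bern_conv. simpl csum. rewrite bernC_0 by auto.
    apply C_ext; simpl; field.
  - (* The difference of both sides is constant in q and has integral 0 over [q, q+1]. *)
    set (Psi := fun x => (bern_conv (S k) x - RtoC (x ^ S k / INR (fact (S k))))%C).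
    assert (Hd : forall x, 0 < x -> derivC Psi x 0).
    { intros x Hx. eapply derivC_eq.
      - apply derivC_minus; [now apply bern_conv_derivC|]. apply derivC_RtoC, is_derive_pow_fact.
      - rewrite IH by auto. ring. }
    assert (Hconst : forall x, q <= x <= q + 1 -> Psi x = Psi q).
    { intros x Hx. symmetry. apply derivC_zero_eq; [lra|]. intros; apply Hd; lra. }
    assert (I1 : exists v, is_int Psi q 0 v).
    { eexists.
      (* The integrals of the two sides agree by the binomial theorem; 0 is written as their
         difference so that linearity applies. *)
      replace (RtoC 0) with (csum (S (S k)) (fun j => RtoC (/ INR (fact (S (S k) - j))) * RtoC (q ^ j / INR (fact j)))
        - RtoC (((q + 1) ^ S (S k) - q ^ S (S k)) / INR (fact (S (S k)))))%C.
      2:{ rewrite <- binomial_div_fact.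
          rewrite (csum_ext _ _ (fun j => RtoC (/ INR (fact (S (S k) - j)) * (q ^ j / INR (fact j))))).
          - rewrite csum_RtoC. ring.
          - intros; now rewrite RtoC_mult. }
      apply is_int_minus.
      - apply (is_int_csum (S (S k)) (fun j x => RtoC (/ INR (fact (S (S k) - j))) * bernC j x)%C).
        intros j _. apply is_int_scal. now apply bernC_int.
      - exists (fun x => RtoC (x ^ S (S k) / INR (fact (S (S k))))),
          (fun x => RtoC (x ^ S (S (S k)) / INR (fact (S (S (S k)))))).
        split; [|split; [|split; [|reflexivity]]].
        + intros; apply derivC_RtoC, is_derive_pow_fact.
        + intros; apply derivC_RtoC, is_derive_pow_fact.
        + rewrite <- RtoC_minus. f_equal. field. apply INR_fact_neq_0. }
    assert (I2 : exists v, is_int (fun _ => Psi q) q (Psi q) v).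
    { set (P := fun x : R => (Psi q * RtoC x)%C).
      assert (HP : forall x, derivC P x (Psi q)).
      { intros x. eapply derivC_eq; [apply derivC_scal, (derivC_RtoC (fun t => t)), is_derive_id|].
        change (RtoC one) with (RtoC 1). ring. }
      eexists. exists P, (prim P). split; [auto|split; [|split; [|reflexivity]]].
      - intros x Hx. apply prim_derivC; auto. intros y _. eapply derivC_contC, HP.
      - unfold P. rewrite RtoC_plus. ring. }
    destruct I1 as [v1 I1], I2 as [v2 I2].
    destruct (is_int_unique _ _ q _ _ _ _ Hq Hconst I1 I2) as [E _].
    unfold Psi in E.
    replace (bern_conv (S k) q) with
      ((bern_conv (S k) q - RtoC (q ^ S k / INR (fact (S k)))) + RtoC (q ^ S k / INR (fact (S k))))%C by ring.
    rewrite <- E. ring.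
Qed.

(** The recursion has real coefficients and can be solved for its last term. *)
Lemma bernC_real (q : R) : 0 < q -> forall k, bernC k q = RtoC (Re (bernC k q)).
Proof.
  intros Hq k. induction k as [k IH] using (well_founded_induction Wf_nat.lt_wf).
  assert (E := bern_conv_eq k q Hq). unfold bern_conv in E.
  change (csum k (fun j => RtoC (/ INR (fact (S k - j))) * bernC j q)
    + RtoC (/ INR (fact (S k - k))) * bernC k q = RtoC (q ^ k / INR (fact k)))%C in E.
  replace (RtoC (/ INR (fact (S k - k)))) with (RtoC 1) in E.
  2:{ replace (S k - k)%nat with 1%nat by lia. f_equal. simpl; field. }
  rewrite (csum_ext k _ (fun j => RtoC (/ INR (fact (S k - j)) * Re (bernC j q)))) in E.
  2:{ intros j Hj. rewrite (IH j Hj) at 1. now rewrite RtoC_mult. }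
  assert (Z : exists r, csum k (fun j => RtoC (/ INR (fact (S k - j)) * Re (bernC j q))) = RtoC r).
  { destruct k; eexists; [reflexivity|apply csum_RtoC]. }
  destruct Z as [r Z]. rewrite Z in E.
  assert (E' : bernC k q = RtoC (q ^ k / INR (fact k) - r))  by (rewrite RtoC_minus, <- E; ring).
  rewrite E'. reflexivity.
Qed.

(** * The generating function of the Bernoulli polynomials *)

Definition bern (q : R) (k : nat) : R := Re (bernC k q).

Lemma bern_rec (q : R) (k : nat) : 0 < q ->
  sum_f_R0 (fun j => bern q j * / INR (fact (S (k - j)))) k = q ^ k / INR (fact k).
Proof.
  intros Hq. apply RtoC_inj. rewrite <- csum_RtoC, <- bern_conv_eq by auto.
  apply csum_ext. intros j Hj. rewrite (bernC_real q Hq j). unfold bern.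
  rewrite <- RtoC_mult. f_equal. rewrite Rmult_comm. do 4 f_equal. lia.
Qed.

Lemma INR_fact_ge_2 (n : nat) : (2 <= n)%nat -> 2 <= INR (fact n).
Proof.
  intros Hn. change 2 with (INR (fact 2)). apply le_INR. now apply fact_le.
Qed.

Lemma sum_pow_le (A : R) (k : nat) : 2 <= A -> sum_f_R0 (fun j => A ^ j) k <= A ^ S k.
Proof.
  intros HA. induction k; [simpl; lra|]. rewrite tech5.
  assert (0 < A ^ S k) by (apply pow_lt; lra). simpl in *. nra.
Qed.

(** In the recursion the factorials dividing the earlier terms are at least 2, which cancels the 2
    of the induction hypothesis. Because 2 + q >= 2, the remaining geometric sum is at most (2 +
    q)^k, and so is q^k / k!. *)
Lemma bern_bound (q : R) (k : nat) : 0 < q -> Rabs (bern q k) <= 2 * (2 + q) ^ k.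
Proof.
  intros Hq. induction k as [k IH] using (well_founded_induction Wf_nat.lt_wf).
  assert (E := bern_rec q k Hq). set (A := 2 + q) in *.
  destruct k as [|k].
  - replace (bern q 0) with 1 by (unfold bern; now rewrite bernC_0). rewrite Rabs_R1. simpl; lra.
  - rewrite tech5, Nat.sub_diag in E.
    replace (/ INR (fact 1)) with 1 in E by (simpl; field). rewrite Rmult_1_r in E.
    set (Sm := sum_f_R0 (fun j => bern q j * / INR (fact (S (S k - j)))) k) in *.
    assert (HS : Rabs Sm <= A ^ S k).
    { eapply Rle_trans; [apply Rsum_abs|].
      eapply Rle_trans; [|apply (sum_pow_le A k); unfold A; lra].
      apply sum_Rle. intros j Hj. rewrite Rabs_mult.
      assert (F := INR_fact_ge_2 (S (S k - j)) ltac:(lia)).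
      rewrite (Rabs_right (/ _)) by (apply Rle_ge; left; apply Rinv_0_lt_compat; lra).
      specialize (IH j ltac:(lia)).
      apply Rmult_le_reg_r with (INR (fact (S (S k - j)))); [lra|].
      rewrite Rmult_assoc, Rinv_l, Rmult_1_r by lra.
      eapply Rle_trans; [exact IH|]. rewrite (Rmult_comm 2).
      apply Rmult_le_compat_l; [apply pow_le; unfold A; lra|auto]. }
    assert (HP : 0 <= q ^ S k / INR (fact (S k)) <= A ^ S k).
    { assert (F := INR_fact_lt_0 (S k)). assert (P : 0 < q ^ S k) by now apply pow_lt.
      assert (F1 : 1 <= INR (fact (S k))) by (change 1 with (INR 1); apply le_INR; apply lt_O_fact).
      split; [apply Rmult_le_pos; [lra|left; now apply Rinv_0_lt_compat]|].
      apply Rle_trans with (q ^ S k).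
      - apply Rmult_le_reg_r with (INR (fact (S k))); auto. unfold Rdiv. rewrite Rmult_assoc, Rinv_l, Rmult_1_r by lra. nra.
      - apply pow_incr. unfold A. lra. }
    apply Rabs_le. apply Rabs_le_between in HS. lra.
Qed.

Lemma CV_radius_ge (a : nat -> R) (r M : R) : (forall n, Rabs (a n * r ^ n) <= M) ->
  Rbar_le r (CV_radius a).
Proof. intros H. apply (proj1 (CV_radius_bounded a)). now exists M. Qed.

Lemma bern_CV (q : R) : 0 < q -> Rbar_le (/ (2 + q)) (CV_radius (bern q)).
Proof.
  intros Hq. apply CV_radius_ge with 2. intros n. assert (B := bern_bound q n Hq).
  rewrite Rabs_mult, <- RPow_abs, (Rabs_right (/ (2 + q))).
  - apply Rmult_le_reg_r with ((2 + q) ^ n); [apply pow_lt; lra|].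
    rewrite Rmult_assoc, <- Rpow_mult_distr, Rinv_l, pow1 by lra. lra.
  - left. apply Rinv_0_lt_compat; lra.
Qed.

Lemma is_pseries_expm1 (t : R) : t <> 0 ->
  is_pseries (fun n => / INR (fact (S n))) t ((exp t - 1) / t).
Proof.
  intros Ht. evar_last.
  - apply (is_pseries_decr_1 (K := R_AbsRing) (V := R_NormedModule) (fun n => / INR (fact n)) t (/ t)).
    + unfold mult, one; simpl. field; auto.
    + apply is_exp_Reals.
  - unfold scal, plus, opp; simpl. unfold mult; simpl. field; auto.
Qed.

Lemma expm1_CV : forall r, 0 < r -> Rbar_le r (CV_radius (fun n => / INR (fact (S n)))).
Proof.
  intros r Hr. apply CV_radius_ge with (exp r / r). intros n.
  assert (P : 0 < / INR (fact (S n))) by (apply Rinv_0_lt_compat, INR_fact_lt_0).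
  assert (Q : 0 < r ^ n) by now apply pow_lt.
  rewrite Rabs_right by (apply Rle_ge, Rmult_le_pos; lra).
  assert (B := pow_div_fact_le_exp r (S n) ltac:(lra)).
  apply Rmult_le_reg_r with r; auto. unfold Rdiv in *. rewrite (Rmult_assoc (exp r)), Rinv_l by lra.
  simpl pow in B. lra.
Qed.

Lemma exp_neq_1 (t : R) : t <> 0 -> exp t - 1 <> 0.
Proof.
  intros Ht E. apply Ht. apply exp_inv. rewrite exp_0. lra.
Qed.

(** [bern_rec] says that the Cauchy product with the series of (e^t - 1) / t is the series of
    e^(qt). *)
Lemma bern_is_Bernoulli (q : R) : 0 < q -> is_Bernoulli q (fun k => bern q k * INR (fact k)).
Proof.
  intros Hq. assert (HA : 0 < / (2 + q)) by (apply Rinv_0_lt_compat; lra).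
  exists (/ (2 + q)). split; auto. intros t Ht Htr.
  assert (C1 : Rbar_lt (Rabs t) (CV_radius (bern q))).
  { eapply Rbar_lt_le_trans; [|now apply bern_CV]. exact Htr. }
  assert (C2 : Rbar_lt (Rabs t) (CV_radius (fun n => / INR (fact (S n))))).
  { eapply Rbar_lt_le_trans; [|apply (expm1_CV (/ (2 + q)) HA)]. exact Htr. }
  assert (S1 := PSeries_correct _ _ (CV_radius_inside _ _ C1)).
  assert (S2 := is_pseries_mult _ _ t _ _ S1 (is_pseries_expm1 t Ht) C1 C2).
  assert (S3 : is_pseries (fun n => q ^ n / INR (fact n)) t (exp (q * t))).
  { assert (S := is_exp_Reals (q * t)). unfold is_pseries in S |- *.
    eapply is_series_ext; [|exact S]. intros n. unfold scal; simpl. unfold mult; simpl.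
    rewrite (pow_n_pow (q * t)), (pow_n_pow t), Rpow_mult_distr. unfold Rdiv. ring. }
  assert (E : PSeries (bern q) t * ((exp t - 1) / t) = exp (q * t)).
  { rewrite <- (is_pseries_unique _ _ _ S2), <- (is_pseries_unique _ _ _ S3).
    apply PSeries_ext. intros n. unfold PS_mult. now apply bern_rec. }
  assert (N := exp_neq_1 t Ht).
  replace (t * exp (q * t) / (exp t - 1)) with (PSeries (bern q) t).
  2:{ rewrite <- E. field; auto. }
  eapply is_series_ext; [|exact S1]. intros n. simpl. f_equal. field. apply INR_fact_neq_0.
Qed.

Lemma CV_radius_ge_ex (a : nat -> R) (t : R) : ex_pseries a t -> Rbar_le (Rabs t) (CV_radius a).
Proof.
  intros H. apply Rbar_not_lt_le. intros N. apply CV_disk_outside in N. apply N.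
  apply ex_series_lim_0. destruct H as [l Hl]. exists l.
  eapply is_series_ext; [|exact Hl]. intros n. rewrite Rmult_comm, <- pow_n_pow. reflexivity.
Qed.

Lemma is_Bernoulli_unique (q : R) (B B' : nat -> R) :
  is_Bernoulli q B -> is_Bernoulli q B' -> forall k, B k = B' k.
Proof.
  intros [r [Hr H]] [r' [Hr' H']] k.
  set (a := fun k => B k / INR (fact k)). set (a' := fun k => B' k / INR (fact k)).
  set (r0 := Rmin r r'). assert (Hr0 : 0 < r0) by now apply Rmin_glb_lt.
  assert (Hh : Rabs (r0 / 2) = r0 / 2) by (apply Rabs_right; lra).
  assert (L1 : r0 <= r) by apply Rmin_l. assert (L2 : r0 <= r') by apply Rmin_r.
  assert (CV : Rbar_le (r0 / 2) (CV_radius a)).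
  { rewrite <- Hh. apply CV_radius_ge_ex. eexists. apply H; [lra|rewrite Hh; lra]. }
  assert (CV' : Rbar_le (r0 / 2) (CV_radius a')).
  { rewrite <- Hh. apply CV_radius_ge_ex. eexists. apply H'; [lra|rewrite Hh; lra]. }
  assert (P : Rbar_lt 0 (CV_radius a)) by (eapply Rbar_lt_le_trans; [|exact CV]; simpl; lra).
  assert (P' : Rbar_lt 0 (CV_radius a')) by (eapply Rbar_lt_le_trans; [|exact CV']; simpl; lra).
  assert (E : forall t, t <> 0 -> Rabs t < r0 -> PSeries a t = PSeries a' t).
  { intros t Ht Htr. rewrite (is_pseries_unique a t _ (H t Ht ltac:(lra))).
    now rewrite (is_pseries_unique a' t _ (H' t Ht ltac:(lra))). }
  (* The generating identity excludes t = 0, so the constant terms are compared by continuity of the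
     two power series. *)
  assert (E0 : PSeries a 0 = PSeries a' 0).
  { assert (K := PSeries_continuity a 0 ltac:(rewrite Rabs_R0; exact P)).
    assert (K' := PSeries_continuity a' 0 ltac:(rewrite Rabs_R0; exact P')).
    apply continuity_pt_filterlim in K, K'.
    assert (K1 := proj1 (continuous_R_eps (PSeries a) 0) K).
    assert (K2 := proj1 (continuous_R_eps (PSeries a') 0) K').
    apply Rminus_diag_uniq. apply Rabs_eq_0.
    apply Rle_antisym; [|apply Rabs_pos]. apply Rle_plus_epsilon. intros e He. rewrite Rplus_0_l.
    destruct (K1 (e/2) ltac:(lra)) as [d1 [D1 Q1]]. destruct (K2 (e/2) ltac:(lra)) as [d2 [D2 Q2]].
    set (t := Rmin r0 (Rmin d1 d2) / 2).
    assert (Hm : 0 < Rmin r0 (Rmin d1 d2)) by (repeat apply Rmin_glb_lt; auto).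
    assert (M1 := Rmin_l r0 (Rmin d1 d2)). assert (M2 := Rmin_r r0 (Rmin d1 d2)).
    assert (M3 := Rmin_l d1 d2). assert (M4 := Rmin_r d1 d2).
    assert (Ht : Rabs t = t) by (apply Rabs_right; unfold t; lra).
    assert (Ht' : 0 < t < Rmin r0 (Rmin d1 d2)) by (unfold t; lra).
    specialize (Q1 t ltac:(rewrite Rminus_0_r, Ht; lra)).
    specialize (Q2 t ltac:(rewrite Rminus_0_r, Ht; lra)).
    rewrite (E t) in Q1 by (rewrite ?Ht; lra).
    apply Rabs_def2 in Q1, Q2. apply Rabs_le. lra. }
  assert (EE : a k = a' k).
  { apply PSeries_ext_recip; auto. exists (mkposreal r0 Hr0). intros t Ht.
    destruct (Req_dec t 0) as [->|N]; auto. apply E; auto.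
    change (Rabs (t - 0) < r0) in Ht. now rewrite Rminus_0_r in Ht. }
  unfold a, a' in EE. apply (f_equal (fun x => x * INR (fact k))) in EE.
  assert (F := INR_fact_neq_0 k). field_simplify in EE; auto.
Qed.

Lemma entire_Bernoulli (k : nat) (q : R) : 0 < q -> entire (RtoC (1 - INR k)) q = RtoC (Bernoulli_poly k q).
Proof.
  intros Hq. assert (HB := bern_is_Bernoulli q Hq).
  assert (HB' : is_Bernoulli q (fun k => Bernoulli_poly k q)).
  { unfold Bernoulli_poly. apply (epsilon_spec (inhabits (fun _ : nat => 0)) (is_Bernoulli q)). eexists; exact HB. }
  rewrite <- (is_Bernoulli_unique q _ _ HB HB' k). unfold bern.
  rewrite RtoC_mult, <- bernC_real by auto. unfold bernC. rewrite RtoC_inv by apply INR_fact_neq_0.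
  field. intros E. apply RtoC_inj in E. now apply INR_fact_neq_0 in E.
Qed.

(** * Balanced negapolygamma functions *)

Lemma harmonic_S (r : nat) : harmonic (S r) = harmonic r + / INR (S r).
Proof. unfold harmonic. rewrite sum_n_Sm by lia. reflexivity. Qed.

(** The coefficient relation for k = 1 at z = -m, where the shift brings in the value G(1-m,q). *)
Lemma entire_der_derivC (m : nat) (q : R) : 0 < q ->
  derivC (entire_der (S m)) q (RtoC (INR (S m)) * entire_der m q - entire (RtoC (1 - INR m)) q)%C.
Proof.
  intros Hq. destruct (entire_coef_derivC (RtoC (1 - INR (S m)))) as [A [d [c [HA [Hd [Hc H]]]]]].
  rewrite RtoC_1_minus_S in Hc.
  apply (derivC_ext_pos (d 1%nat)); auto.
  { intros t Ht. destruct (Hd t t Ht) as [M HM]. symmetry.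
    apply (taylor_C_derive M A (fun k => d k t) (fun z => entire z t)); auto. apply HM; lra. }
  eapply derivC_eq; [now apply H|].
  destruct (Hc q q Hq) as [M HM]. specialize (HM q ltac:(lra)).
  assert (E1 : entire_der m q = c 1%nat q) by exact (taylor_C_derive M A (fun k => c k q) (fun z => entire z q) _ HA HM).
  assert (E0 := taylor_value _ _ _ _ HM). cbv beta in E0.
  rewrite Cplus_0_r in E0. rewrite E1, E0. simpl shift_coef.
  rewrite RtoC_minus. ring.
Qed.

(** The term -B_m / m from [A_neg_entire] joins -H_(m-1) B_m to give -H_m B_m. *)
Lemma negapolygamma_entire (m : nat) (q : R) : (1 <= m)%nat -> 0 < q ->
  negapolygamma m q =
  (- RtoC (/ INR (fact m)) * (entire_der m q + RtoC (harmonic m) * entire (RtoC (1 - INR m)) q))%C.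
Proof.
  intros Hm Hq. unfold negapolygamma. rewrite A_neg_entire, RtoC_mult, <- entire_Bernoulli by auto.
  destruct m as [|m]; [lia|].
  replace (S m - 1)%nat with m by lia.
  rewrite harmonic_S, RtoC_plus. ring.
Qed.

Lemma negapolygamma_derivC (m : nat) (q : R) : (1 <= m)%nat -> 0 < q ->
  derivC (negapolygamma (S m)) q (negapolygamma m q).
Proof.
  intros Hm Hq.
  apply (derivC_ext_pos (fun q => - RtoC (/ INR (fact (S m))) *
    (entire_der (S m) q + RtoC (harmonic (S m)) * entire (RtoC (1 - INR (S m))) q))%C); auto.
  { intros t Ht. symmetry. apply negapolygamma_entire; auto; lia. }
  eapply derivC_eq.
  { apply derivC_scal, derivC_plus; [now apply entire_der_derivC|]. apply derivC_scal, entire_derivC, Hq. }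
  rewrite RtoC_1_minus_S, negapolygamma_entire, harmonic_S by auto.
  assert (N : RtoC (INR (S m)) <> 0).
  { intros E. apply RtoC_inj in E. now apply not_0_INR in E. }
  assert (NF : RtoC (INR (fact m)) <> 0).
  { intros E. apply RtoC_inj in E. now apply INR_fact_neq_0 in E. }
  replace (- (RtoC (1 - INR (S m)) - 1))%C with (RtoC (INR (S m))) by (rewrite RtoC_minus; ring).
  rewrite fact_simpl, mult_INR.
  rewrite !RtoC_inv, RtoC_plus, RtoC_mult, RtoC_inv
    by (try apply Rmult_integral_contrapositive_currified; try apply INR_fact_neq_0; now apply not_0_INR).
  field. auto.
Qed.

Lemma is_derive_pow_div_fact (k : nat) (x : R) :
  is_derive (fun s => s ^ k / INR (fact k)) x
    (match k with O => 0 | S j => x ^ j / INR (fact j) end).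
Proof.
  destruct k; [|apply is_derive_pow_fact].
  apply (is_derive_ext (fun _ => 1)); [intros; simpl; field|apply @is_derive_const].
Qed.

Theorem theorem4p4 (n m : nat) (hm : (1 <= m)%nat) (a b : R) (hb : b <> 0)
  (lo hi : Rbar)
  (hI : forall q : R, Rbar_lt lo q -> Rbar_lt q hi -> 0 < a + b * q) :
  forall q : R, Rbar_lt lo q -> Rbar_lt q hi ->
    is_derive (K := R_AbsRing) (V := C_R_NormedModule)
      (fun x : R =>
         (RtoC (INR (fact n)) *
          sum_n (G := C_AbelianMonoid)
            (fun j : nat =>
               RtoC ((-1) ^ j / (b ^ (j + 1) * INR (fact (n - j))) * x ^ (n - j))
               * negapolygamma (m + j + 1) (a + b * x)) n)%C)
      q
      (RtoC (q ^ n) * negapolygamma m (a + b * q))%C.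
Proof.
  intros q Hlo Hhi. assert (Hy := hI q Hlo Hhi). apply derivC_is_derive.
  set (c := fun j => (-1) ^ j / b ^ j).
  (* The derivative of the [j]-th summand is [T j - T (S j)]. *)
  set (T := fun j => if (j <=? n)%nat
    then (RtoC (c j * (q ^ (n - j) / INR (fact (n - j)))) * negapolygamma (m + j) (a + b * q))%C
    else RtoC 0).
  assert (Hu : is_derive (fun x : R => a + b * x) q b).
  { auto_derive; auto; ring. }
  apply (derivC_ext (fun x => RtoC (INR (fact n)) * csum (S n) (fun j =>
    RtoC (c j / b) * (RtoC (x ^ (n - j) / INR (fact (n - j))) * negapolygamma (S (m + j)) (a + b * x))))%C).
  { intros x. rewrite csum_sum_n. f_equal. apply csum_ext. intros j _.
    replace (m + j + 1)%nat with (S (m + j)) by lia.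
    rewrite Cmult_assoc, <- RtoC_mult. do 2 f_equal. unfold c.
    rewrite Nat.add_1_r. simpl (b ^ S j). field. repeat split; auto using INR_fact_neq_0, pow_nonzero. }
  eapply derivC_eq.
  { apply derivC_scal.
    apply (derivC_csum (S n) (fun j x => RtoC (c j / b) * (RtoC (x ^ (n - j) / INR (fact (n - j))) * negapolygamma (S (m + j)) (a + b * x)))%C q
      (fun j => T j - T (S j))%C).
    intros j Hj. eapply derivC_eq.
    { apply derivC_scal, derivC_mult; [apply derivC_RtoC, is_derive_pow_div_fact|].
      apply (derivC_comp (negapolygamma (S (m + j))) (fun x => a + b * x) q); [|exact Hu].
      apply negapolygamma_derivC; [lia|exact Hy]. }
    assert (Hb0 : RtoC b <> 0) by (intros E; now apply RtoC_inj in E).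
    unfold T. replace (j <=? n)%nat with true by (symmetry; apply Nat.leb_le; lia).
    rewrite Nat.add_succ_r.
    set (W := negapolygamma (S (m + j)) (a + b * q)). set (V := negapolygamma (m + j) (a + b * q)).
    (* This sign and factor turn the derivative of the power into -T (S j), while the inner
       derivative b restores T j. *)
    assert (Hc : c (S j) = - (c j / b)).
    { unfold c. simpl. field. split; auto using pow_nonzero. }
    destruct (Nat.leb_spec (S j) n) as [h|h].
    - replace (n - j)%nat with (S (n - S j)) by lia. cbv iota beta.
      rewrite Hc, !RtoC_mult, RtoC_opp, RtoC_div by auto. field. auto.
    (* The last summand j = n: its power is constant, in accordance with T (S n) = 0. *)
    - replace (n - j)%nat with O by lia. cbv iota beta.
      rewrite !RtoC_mult, RtoC_div by auto. field. auto. }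
  (* Only T 0 survives, and n! cancels the denominator of its coefficient q^n / n!. *)
  rewrite (csum_ext (S n) _ (fun j => - (T (S j) - T j))%C) by (intros; ring).
  rewrite csum_telescope_opp. unfold T.
  replace (0 <=? n)%nat with true by (symmetry; apply Nat.leb_le; lia).
  replace (S n <=? n)%nat with false by (symmetry; apply Nat.leb_gt; lia).
  rewrite Nat.sub_0_r, Nat.add_0_r. unfold c.
  replace ((-1) ^ 0 / b ^ 0 * (q ^ n / INR (fact n))) with (/ INR (fact n) * q ^ n) by (simpl; field; apply INR_fact_neq_0).
  rewrite RtoC_mult, RtoC_inv by apply INR_fact_neq_0.
  field. intros E. apply RtoC_inj in E. now apply INR_fact_neq_0 in E.
Qed.
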